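(* Let $d\ge1$ and let $M\subseteq\mathbb{R}^d$ be a nonempty multirectangle. Every nontrivial subgroup of $\operatorname{Rec}_d(M)$ that is normalized by the derived subgroup $D(\operatorname{Rec}_d(M))$ contains $D(\operatorname{Rec}_d(M))$. In particular, $D(\operatorname{Rec}_d(M))$ is a simple group, and it is contained in every nontrivial normal subgroup of $\operatorname{Rec}_d(M)$.
   Context: A rectangle in $\mathbb{R}^d$ is a set $\prod_{i=1}^d[a_i,b_i)$ with $a_i<b_i$ real numbers. A multirectangle is a finite union of rectangles. For a multirectangle $M\subseteq\mathbb{R}^d$, $\operatorname{Rec}_d(M)$ denotes the group, under composition, of all bijections $f:M\to M$ for which there exists a finite partition of $M$ into rectangles such that the restriction of $f$ to each piece is a translation. $D(G)$ denotes the derived (commutator) subgroup of a group $G$. *)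

(* Defs.v *)
From mathcomp Require Import all_boot all_order all_algebra.
From mathcomp Require Import reals.
Set Implicit Arguments. Unset Strict Implicit. Unset Printing Implicit Defensive.
Import Order.TTheory GRing.Theory Num.Theory.
Local Open Scope ring_scope.

Definition point (R : realType) (d : nat) := 'I_d -> R.

Definition in_rect (R : realType) (d : nat) (a b : point R d) (x : point R d) : Prop :=
  forall i : 'I_d, a i <= x i /\ x i < b i.

Definition proper_box (R : realType) (d : nat) (a b : point R d) : Prop :=
  forall i : 'I_d, a i < b i.

Definition multirectangle (R : realType) (d : nat) (M : point R d -> Prop) : Prop :=
  exists (n : nat) (a b : 'I_n -> point R d),
    (forall j, proper_box (a j) (b j)) /\
    (forall x, M x <-> exists j, in_rect (a j) (b j) x).

Definition translate (R : realType) (d : nat) (t x : point R d) : point R d :=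
  fun i => x i + t i.

(* Elements of Rec_d(M), represented as maps of R^d which are the identity
   outside M (this is a bijective correspondence with bijections M -> M). *)
Definition in_Rec (R : realType) (d : nat) (M : point R d -> Prop)
    (f : point R d -> point R d) : Prop :=
  (forall x, ~ M x -> f x = x) /\
  (forall x, M x -> M (f x)) /\
  (forall x y, M x -> M y -> f x = f y -> x = y) /\
  (forall y, M y -> exists x, M x /\ f x = y) /\
  (exists (n : nat) (a b t : 'I_n -> point R d),
     (forall j, proper_box (a j) (b j)) /\
     (forall j k, j <> k -> forall x, ~ (in_rect (a j) (b j) x /\ in_rect (a k) (b k) x)) /\
     (forall x, M x <-> exists j, in_rect (a j) (b j) x) /\
     (forall j x, in_rect (a j) (b j) x -> f x = translate (t j) x)).

Definition is_subgroup (T : Type) (H : (T -> T) -> Prop) : Prop :=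
  H id /\
  (forall f g, H f -> H g -> H (f \o g)) /\
  (forall f, H f -> exists g, H g /\ g \o f = id /\ f \o g = id).

Definition subset_of (T : Type) (H K : (T -> T) -> Prop) : Prop :=
  forall f, H f -> K f.

(* c is a commutator a b a^-1 b^-1 of elements a, b of G. *)
Definition is_commutator (T : Type) (G : (T -> T) -> Prop) (c : T -> T) : Prop :=
  exists a b, G a /\ G b /\ c \o (b \o a) = a \o b.

Definition derived (T : Type) (G : (T -> T) -> Prop) (f : T -> T) : Prop :=
  forall H, is_subgroup H -> subset_of H G -> subset_of (is_commutator G) H -> H f.

Definition normalized_by (T : Type) (H K : (T -> T) -> Prop) : Prop :=
  forall k k' h, K k -> k' \o k = id -> k \o k' = id -> H h -> H (k \o h \o k').

Definition nontrivial (T : Type) (H : (T -> T) -> Prop) : Prop :=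
  exists h, H h /\ h <> id.

Definition normal_subgroup (T : Type) (N G : (T -> T) -> Prop) : Prop :=
  is_subgroup N /\ subset_of N G /\ normalized_by N G.

Definition simple_group (T : Type) (G : (T -> T) -> Prop) : Prop :=
  nontrivial G /\
  forall N, normal_subgroup N G -> (forall f, N f <-> f = id) \/ (forall f, N f <-> G f).

(* Main.v *)
Require Import Defs.
From mathcomp Require Import all_boot all_order all_algebra.
From mathcomp Require Import reals boolp.
From mathcomp Require Import ring lra zify.
Set Implicit Arguments. Unset Strict Implicit. Unset Printing Implicit Defensive.
Import Order.TTheory GRing.Theory Num.Theory.
Local Open Scope ring_scope.

(** Write G for the group, D for its derived subgroup and A for the normal
subgroup of G generated by the involutions. Then A = D:
- Every involution u is a commutator of two involutions: u exchanges two sets E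
  and u E, each of which can be cut into two halves that are translates of each
  other piece by piece.
- G / A is abelian. Fix a small cube B of M. Any f in G can be multiplied by
  elements of A until it is supported in B: a small set E outside B is made
  fixed by moving f E to a set E' in B that is disjoint from f E, and then E' to
  E. Such an E', equidecomposable with E, exists because f E meets few cells of
  a fine grid. Two elements supported in B commute modulo A, since an involution
  moves B off itself.
Let H be nontrivial and normalized by D, and let h in H move a small cube Q off
itself. For involutions a, b supported in Q, H contains [[h, a], b] = [a, b],
hence all involutions of Q. Every involution of M is a product of exchanges
of two tiny sets, and these are conjugate under A to involutions of Q. So A is
contained in H. *)

(** * Piecewise translations *)

Section PiecewiseTranslations.
Variables (R : realType) (d : nat).
Implicit Types (C : seq R) (x y : point R d) (X W : point R d -> Prop).
Implicit Types (f g u : point R d -> point R d).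

(* The list [C] cuts every coordinate axis; the cells of the resulting grid
   are boxes, some of them unbounded. *)
Definition same_cell C x y := forall i p, p \in C -> (p <= x i) = (p <= y i).

(** Such a set is a union of grid cells. Unbounded cells are allowed, so these sets are closed under
    complements. *)
Definition rset X := exists C, forall x y, same_cell C x y -> X x -> X y.

Definition pwtrans f :=
  exists C, forall x y, same_cell C x y -> forall i, f x i - x i = f y i - y i.

Lemma same_cell_sym C x y : same_cell C x y -> same_cell C y x.
Proof. by move=> h i p /h ->. Qed.

Lemma same_cell_sub C C' x y :
  {subset C <= C'} -> same_cell C' x y -> same_cell C x y.
Proof. by move=> sub h i p /sub /h ->. Qed.

Lemma same_cell_cat C C' x y :
  same_cell (C ++ C') x y -> same_cell C x y /\ same_cell C' x y.
Proof.
by move=> h; split; apply: same_cell_sub h => p; rewrite mem_cat => ->;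
  rewrite ?orbT.
Qed.

Lemma rset_const (P : Prop) : rset (fun=> P).
Proof. by exists [::]. Qed.

Lemma rsetC X : rset X -> rset (fun x => ~ X x).
Proof.
move=> [C h]; exists C => x y xy nX Xy; apply: nX.
exact: h (same_cell_sym xy) Xy.
Qed.

Lemma rsetI X W : rset X -> rset W -> rset (fun x => X x /\ W x).
Proof.
move=> [C h] [C' h']; exists (C ++ C') => x y /same_cell_cat[a b] [Xx Wx].
by split; [apply: h a _|apply: h' b _].
Qed.

Lemma rsetU X W : rset X -> rset W -> rset (fun x => X x \/ W x).
Proof.
move=> [C h] [C' h']; exists (C ++ C') => x y /same_cell_cat[a b] [Xx|Wx].
  by left; apply: h a _.
by right; apply: h' b _.
Qed.

Lemma pwtrans_id : pwtrans id.
Proof. by exists [::] => x y _ i; rewrite !subrr. Qed.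

Lemma pwtrans_translate (t : point R d) : pwtrans (translate t).
Proof. by exists [::] => x y _ i; rewrite /translate; ring. Qed.

Lemma pwtrans_if X f g : rset X -> pwtrans f -> pwtrans g ->
  pwtrans (fun x => if `[<X x>] then f x else g x).
Proof.
move=> [C h] [C1 h1] [C2 h2]; exists (C ++ (C1 ++ C2)) => x y.
move=> /same_cell_cat[a] /same_cell_cat[b c] i.
have -> : `[<X x>] = `[<X y>].
  by apply: asbool_equiv_eq; split; apply: h => //; apply: same_cell_sym.
by case: asboolP => _; [apply: h1|apply: h2].
Qed.

(* The displacements of a piecewise translation take finitely many values
   because a cut list has only finitely many cells. *)
Lemma pwtrans_disp f : pwtrans f -> exists T : seq R, forall x i, f x i - x i \in T.
Proof.
move=> [C h].
pose sg x : {ffun 'I_d * 'I_(size C) -> bool} := [ffun q : 'I_d * 'I_(size C) => nth 0 C q.2 <= x q.1].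
have sgP x y : sg x = sg y -> same_cell C x y.
  move=> /ffunP e i p pC; have lt : (index p C < size C)%N by rewrite index_mem.
  by have := e (i, Ordinal lt); rewrite !ffunE /= nth_index.
have /choice[r rP] : forall s, exists x, (exists y, sg y = s) -> sg x = s.
  move=> s; have [[y <-]|no] := pselect (exists y, sg y = s); first by exists y.
  by exists (fun=> 0) => /no.
exists [seq f (r q.1) q.2 - r q.1 q.2 | q : {ffun 'I_d * 'I_(size C) -> bool} * 'I_d] => x i.
apply/imageP; exists (sg x, i) => //=.
by apply: h; apply: sgP; rewrite rP //; exists x.
Qed.

Definition shifted_cuts C (T : seq R) := [seq p - t | p <- C, t <- T].

Lemma same_cell_shift C T x y (t : point R d) :
  (forall i, t i \in T) -> same_cell (shifted_cuts C T) x y ->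
  same_cell C (translate t x) (translate t y).
Proof.
move=> tT h i p pC; rewrite /translate -!lerBlDr; apply: h.
by apply/allpairs_f.
Qed.

(** Only finitely many displacements occur, so it suffices to pull the cuts [C] back along each of
    them and to add the cuts of [f]. *)
Lemma pwtrans_same_cell f C : pwtrans f ->
  exists C', forall x y, same_cell C' x y -> same_cell C (f x) (f y).
Proof.
move=> pf; have [T hT] := pwtrans_disp pf; have [C1 h1] := pf.
exists (C1 ++ shifted_cuts C T) => x y /same_cell_cat[a b].
have ex z : f z = translate (fun i => f z i - z i) z.
  by apply/funext => i; rewrite /translate; ring.
rewrite ex (ex y) -(_ : (fun i => f x i - x i) = (fun i => f y i - y i)).
  exact: same_cell_shift.
by apply/funext => i; apply: h1.
Qed.

Lemma pwtrans_comp f g : pwtrans f -> pwtrans g -> pwtrans (f \o g).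
Proof.
move=> [C h] pg; have [C' h'] := pwtrans_same_cell C pg; have [C1 h1] := pg.
exists (C' ++ C1) => x y /same_cell_cat[/h' /h a /h1 b] i.
by have := a i; have := b i; rewrite /=; lra.
Qed.

Lemma rset_preim f X : pwtrans f -> rset X -> rset (fun x => X (f x)).
Proof.
move=> pf [C h]; have [C' h'] := pwtrans_same_cell C pf.
by exists C' => x y /h' /h.
Qed.

(** The cuts of [X] and [f], pushed forward along all displacements of [f], serve both for the image
    of [X] and for the inverse. *)
Lemma pwtrans_partial_inverse f X : rset X -> pwtrans f ->
  (forall x y, X x -> X y -> f x = f y -> x = y) ->
  exists g, [/\ pwtrans g, (forall x, X x -> g (f x) = x)
             & rset (fun y => exists2 x, X x & f x = y)].
Proof.
move=> [CX hX] pf inj; have [T hT] := pwtrans_disp pf; have [C1 h1] := pf.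
(* Translating [y'] back by the displacement at [x] stays in the cell of [x], so [f] sends the
   resulting point to [y']. *)
have back x y' : same_cell (shifted_cuts (CX ++ C1) [seq - t | t <- T]) (f x) y' ->
    X x -> exists2 x', X x' & f x' = y' /\ forall i, f x i - x i = y' i - x' i.
  move=> sc Xx.
  have := @same_cell_shift (CX ++ C1) [seq - t | t <- T] _ _ (fun i => - (f x i - x i))
    (fun i => map_f _ (hT x i)) sc.
  have -> : translate (fun i => - (f x i - x i)) (f x) = x.
    by apply/funext => i; rewrite /translate; ring.
  set x' := translate _ _ => /same_cell_cat[/hX a /h1 b]; exists x'; first exact: a.
  split; last by move=> i; rewrite /x' /translate; ring.
  by apply/funext => i; have := b i; rewrite /x' /translate; lra.
(* Off the image of [X], [g] is the identity, with displacement zero. *)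
have /choice[g gP] : forall y, exists x,
    ((exists2 x, X x & f x = y) -> X x /\ f x = y) /\
    (~ (exists2 x, X x & f x = y) -> x = y).
  move=> y; have [[x Xx fx]|no] := pselect (exists2 x, X x & f x = y).
    by exists x; split=> // no; case: no; exists x.
  by exists y.
have gf x : X x -> g (f x) = x.
  by move=> Xx; have [] := (gP (f x)).1 (ex_intro2 _ _ x Xx erefl) => a; apply: inj.
exists g; split=> //.
  exists (shifted_cuts (CX ++ C1) [seq - t | t <- T]) => y y' sc i.
  have [[x Xx e]|no] := pselect (exists2 x, X x & f x = y).
    rewrite -e in sc *; have [x' Xx' [e' dd]] := back _ _ sc Xx.
    by rewrite gf // -e' gf //; have := dd i; rewrite -e'; lra.
  have no' : ~ (exists2 x, X x & f x = y').
    move=> [x' Xx' e']; apply: no; rewrite -e' in sc.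
    by have [x Xx []] := back _ _ (same_cell_sym sc) Xx'; exists x.
  by rewrite (gP y).2 // (gP y').2 // !subrr.
exists (shifted_cuts (CX ++ C1) [seq - t | t <- T]) => y y' sc [x Xx e].
by rewrite -e in sc; have [x' Xx' []] := back _ _ sc Xx; exists x'.
Qed.

End PiecewiseTranslations.

(** * Nearest elements of a finite list *)

Lemma seq_max_le (R : realType) (s : seq R) (x : R) : has (fun p => p <= x) s ->
  exists p, [/\ p \in s, p <= x & forall q, q \in s -> q <= x -> q <= p].
Proof.
elim: s => //= a s IH; have [/IH[p [ps px pm]] _|/hasPn no] := boolP (has _ s).
  have [ax|xa] := leP a x; last first.
    exists p; split=> [||q]; rewrite ?inE ?ps ?orbT // => /orP[/eqP->|/pm]; last exact.
    by rewrite leNgt xa.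
  exists (Num.max a p); split=> [||q]; last 1 first.
  - by rewrite inE le_max => /orP[/eqP->|/pm h /h->]; rewrite ?lexx ?orbT.
  - by rewrite inE; case: leP; rewrite ?eqxx ?ps ?orbT.
  - by rewrite ge_max ax.
rewrite orbF => ax; exists a; split=> [||q]; rewrite ?mem_head //.
by rewrite inE => /orP[/eqP-> //|/no/negbTE->].
Qed.

Lemma seq_min_gt (R : realType) (s : seq R) (x : R) : has (fun p => x < p) s ->
  exists p, [/\ p \in s, x < p & forall q, q \in s -> x < q -> p <= q].
Proof.
elim: s => //= a s IH; have [/IH[p [ps px pm]] _|/hasPn no] := boolP (has _ s).
  have [ax|xa] := leP a x.
    exists p; split=> [||q]; rewrite ?inE ?ps ?orbT // => /orP[/eqP->|/pm]; last exact.
    by rewrite ltNge ax.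
  exists (Num.min a p); split=> [||q]; last 1 first.
  - by rewrite inE ge_min => /orP[/eqP->|/pm h /h->]; rewrite ?lexx ?orbT.
  - by rewrite inE; case: leP; rewrite ?eqxx ?ps ?orbT.
  - by rewrite lt_min xa.
rewrite orbF => ax; exists a; split=> [||q]; rewrite ?mem_head //.
by rewrite inE => /orP[/eqP-> //|/no/negbTE->].
Qed.

(** * The group Rec as piecewise translations of the whole space *)

Section Rec.
Variables (R : realType) (d : nat).
Implicit Types (C : seq R) (x y : point R d) (X W M : point R d -> Prop).
Implicit Types (f g u : point R d -> point R d).

(** A form of [in_Rec] free of partitions, in which composition and inversion are easy; [in_RecE]
    shows that the two agree on a multirectangle. *)
Definition rec_on W f :=
  [/\ forall x, ~ W x -> f x = x, exists g, cancel f g /\ cancel g f & pwtrans f].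

Definition bounded M := exists lo hi, forall x, M x -> forall i, lo <= x i < hi.

Lemma rset_rect (a b : point R d) : rset (in_rect a b).
Proof.
exists ([seq a i | i <- enum 'I_d] ++ [seq b i | i <- enum 'I_d]) => x y.
move=> /same_cell_cat[ca cb] xr i; have [] := xr i.
by rewrite !ltNge (ca i) ?(cb i) // map_f ?mem_enum.
Qed.

Lemma multirectangle_rset M : multirectangle M -> rset M.
Proof.
move=> [n [a [b [_ hM]]]].
have /choice[C hC] : forall j : 'I_n, exists C, forall x y,
  same_cell C x y -> in_rect (a j) (b j) x -> in_rect (a j) (b j) y.
  by move=> j; apply: rset_rect.
exists (flatten [seq C j | j <- enum 'I_n]) => x y xy /hM[j xj]; apply/hM.
exists j; apply: hC xj; apply: same_cell_sub xy => p pC.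
by apply/flattenP; exists (C j) => //; apply: map_f; rewrite mem_enum.
Qed.

Lemma multirectangle_bounded M : multirectangle M -> bounded M.
Proof.
move=> [n [a [b [_ hM]]]].
pose B := \sum_j \sum_i (`|a j i| + `|b j i|).
have bB (j : 'I_n) (i : 'I_d) : `|a j i| + `|b j i| <= B.
  rewrite /B (bigD1 j) //= (bigD1 i) //= -addrA lerDl addr_ge0 //.
    by apply: sumr_ge0 => k _; apply: addr_ge0.
  by apply: sumr_ge0 => k _; apply: sumr_ge0 => l _; apply: addr_ge0.
exists (- B), B => x /hM[j xj] i; have [h1 h2] := xj i.
have := bB j i; have := ler_norm (- a j i); have := ler_norm (b j i).
have := normr_ge0 (a j i); have := normr_ge0 (b j i); rewrite normrN; lra.
Qed.

Lemma in_Rec_rec_on M f : in_Rec M f -> rec_on M f.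
Proof.
move=> [out [mapM [inj [surj [n [a [b [t [_ [_ [cov tr]]]]]]]]]]]; split=> //.
  have /choice[g gP] : forall y, exists x, f x = y.
    move=> y; have [/surj[x []]|/out] := pselect (M y); last by exists y.
    by exists x.
  exists g; split=> // x.
  have H z z' : M z -> ~ M z' -> f z <> f z'.
    by move=> Mz nz e; case: (nz); rewrite -(out _ nz) -e; apply: mapM.
  have [Mx|nx] := pselect (M x); have [Mgx|ngx] := pselect (M (g (f x))).
  - by apply: inj => //; rewrite gP.
  - by case: (H x _ Mx ngx); rewrite gP.
  - by case: (H _ x Mgx nx); rewrite gP.
  - by rewrite -[LHS](out _ ngx) gP out.
have /choice[C hC] : forall j : 'I_n, exists C, forall x y,
  same_cell C x y -> in_rect (a j) (b j) x -> in_rect (a j) (b j) y.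
  by move=> j; apply: rset_rect.
exists (flatten [seq C j | j <- enum 'I_n]) => x y xy i.
have {}xy j : same_cell (C j) x y.
  apply: same_cell_sub xy => p pC.
  by apply/flattenP; exists (C j) => //; apply: map_f; rewrite mem_enum.
have [[j xj]|nox] := pselect (exists j, in_rect (a j) (b j) x).
  by rewrite (tr j x) // (tr j y) ?/translate; [ring|apply: hC xj].
rewrite !out ?subrr // => /cov // -[j yj]; apply: nox; exists j.
exact: hC (same_cell_sym (xy j)) yj.
Qed.

(* The pieces are the cells of a list of cuts for both M and f; such a cell is
   named by its lower corner. *)
Lemma rec_on_in_Rec M f : multirectangle M -> rec_on M f -> in_Rec M f.
Proof.
move=> mM [out [g [fg gf]] pf].
have injf x y : f x = f y -> x = y by move=> /(congr1 g); rewrite !fg.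
have mapM x : M x -> M (f x).
  move=> Mx; have [//|nM] := pselect (M (f x)).
  by case: (nM); rewrite (injf _ _ (out _ nM)).
do 2![split=> //]; split; first by move=> x y _ _; apply: injf.
split.
  move=> y My; exists (g y); split=> //; have [//|nM] := pselect (M (g y)).
  by case: (nM); rewrite -(out _ nM) gf.
have [Cf hf] := pf; have [CM hM] := multirectangle_rset mM.
have [lo [hi bM]] := multirectangle_bounded mM.
(* The bounds [lo] and [hi] give every point of [M] a cut below and a cut above it in each
   coordinate. Without repetitions, distinct indices name distinct corners. *)
pose D := undup (lo :: hi :: (Cf ++ CM)).
have memD p : p \in [:: lo, hi & Cf ++ CM] -> p \in D by rewrite mem_undup.
have sD x y : same_cell D x y -> same_cell Cf x y /\ same_cell CM x y.
  move=> h; apply: same_cell_cat; apply: same_cell_sub h => p pC.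
  by apply: memD; rewrite !inE pC !orbT.
have /choice[nxt nxtP] : forall p, exists q, p < hi ->
    [/\ q \in D, p < q & forall r, r \in D -> p < r -> q <= r].
  move=> p; have [ph|ph] := ltP p hi; last by exists p.
  have [|q qP] := @seq_min_gt R D p; last by exists q.
  by apply/hasP; exists hi => //; apply: memD; rewrite !inE eqxx orbT.
pose I := {ffun 'I_d -> 'I_(size D)}.
pose pt (q : I) : point R d := fun i => D`_(q i).
have ptD q i : pt q i \in D by apply: mem_nth.
have boxP q y : M (pt q) ->
    in_rect (pt q) (fun i => nxt (pt q i)) y <-> same_cell D (pt q) y.
  move=> Mq; have lt i : pt q i < hi by have /andP[] := bM _ Mq i.
  split=> [yq i p pD|yq i].
    have [nD nl nm] := nxtP _ (lt i); have [y1 y2] := yq i.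
    have [pq|qp] := leP p (pt q i); first by rewrite (le_trans pq).
    by apply/esym/negbTE; rewrite -ltNge (lt_le_trans y2) // nm.
  have [nD nl nm] := nxtP _ (lt i).
  by split; [rewrite -(yq i) // ptD|rewrite ltNge -(yq i) // -ltNge].
have cellP x : M x -> exists q, same_cell D (pt q) x.
  move=> Mx.
  have /choice[p pP] : forall i, exists k : 'I_(size D),
     forall r, r \in D -> (r <= D`_k) = (r <= x i).
    move=> i; have [|p [pD px pm]] := @seq_max_le R D (x i).
      apply/hasP; exists lo; last by have /andP[] := bM _ Mx i.
      by apply: memD; rewrite mem_head.
    have lt : (index p D < size D)%N by rewrite index_mem.
    exists (Ordinal lt) => r rD; rewrite /= nth_index //.
    by apply/idP/idP => [rp|]; [apply: le_trans px|apply: pm].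
  by exists [ffun i => p i] => i r rD; rewrite /pt ffunE pP.
pose S := [set q : I | `[<M (pt q)>]].
have SM (j : 'I_#|S|) : M (pt (enum_val j)).
  by have := enum_valP j; rewrite inE => /asboolP.
exists #|S|, (fun j => pt (enum_val j)), (fun j i => nxt (pt (enum_val j) i)),
  (fun j i => f (pt (enum_val j)) i - pt (enum_val j) i).
split; [|split; [|split]].
- move=> j i; have [|//] := nxtP (pt (enum_val j) i).
  by have /andP[] := bM _ (SM j) i.
- move=> j k jk x [/(boxP _ _ (SM j)) xj /(boxP _ _ (SM k)) xk].
  apply: jk; apply: enum_val_inj; apply/ffunP => i; apply/val_inj/eqP.
  rewrite -(nth_uniq 0 _ _ (undup_uniq [:: lo, hi & Cf ++ CM])) ?ltn_ord //.
  by rewrite eq_le (xk i) ?ptD // -(xj i) ?ptD // lexx (xj i) ?ptD // -(xk i) ?ptD // lexx.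
- move=> x; split=> [Mx|[j /(boxP _ _ (SM j)) /sD[_ xj]]]; last exact: hM xj (SM j).
  have [q qx] := cellP x Mx.
  have Mq : M (pt q) by apply: hM Mx; apply: same_cell_sym; case: (sD _ _ qx).
  have qS : q \in S by rewrite inE; apply/asboolP.
  exists (enum_rank_in qS q); apply/(boxP _ _ (SM _)).
  by rewrite enum_rankK_in.
- move=> j x /(boxP _ _ (SM j)) /sD[/hf h _]; apply/funext => i.
  by have := h i; rewrite /translate; lra.
Qed.

Lemma in_RecE M : multirectangle M -> in_Rec M = rec_on M.
Proof.
move=> mM; apply/funext => f; apply/propext; split; first exact: in_Rec_rec_on.
exact: rec_on_in_Rec.
Qed.

Lemma rec_on_id W : rec_on W id.
Proof. by split=> //; [exists id|apply: pwtrans_id]. Qed.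

Lemma rec_on_comp W f g : rec_on W f -> rec_on W g -> rec_on W (f \o g).
Proof.
move=> [of_ [f' [ff' f'f]] pf] [og [g' [gg' g'g]] pg]; split.
- by move=> x nx /=; rewrite og ?of_.
- by exists (g' \o f'); split; apply: can_comp.
- exact: pwtrans_comp.
Qed.

Lemma rec_on_inv W f g : rec_on W f -> cancel f g -> cancel g f -> rec_on W g.
Proof.
move=> [of_ _ pf] fg gf; split; last 1 first.
- have [|||g' [pg' g'f _]] := @pwtrans_partial_inverse R d f (fun=> True) => //.
  + exact: rset_const.
  + by move=> x y _ _ /(congr1 g); rewrite !fg.
  by rewrite (_ : g = g') //; apply/funext => x; rewrite -{2}(gf x) g'f.
- by move=> x nx; rewrite -{1}(of_ x nx) fg.
- by exists f.
Qed.

Lemma rec_on_sub W X f : (forall x, W x -> X x) -> rec_on W f -> rec_on X f.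
Proof. by move=> sWX [o i p]; split=> // x nX; apply: o => /sWX. Qed.

Lemma rec_on_subgroup W : is_subgroup (rec_on W).
Proof.
split; first exact: rec_on_id.
split=> [f g|f rf]; first exact: rec_on_comp.
have [_ [g [fg gf]] _] := rf; exists g; split; first exact: rec_on_inv rf fg gf.
by split; apply/funext.
Qed.

Lemma rec_on_maps W f x : rec_on W f -> W x -> W (f x).
Proof.
move=> [out [g [fg gf]] pf] Wx; have [//|nW] := pselect (W (f x)).
by case: (nW); rewrite (can_inj fg (out _ nW)).
Qed.

End Rec.

(** * Involutions *)

Section Involutions.
Variables (R : realType) (d : nat).
Implicit Types (C : seq R) (x y : point R d) (X W M : point R d -> Prop).
Implicit Types (f g u a b : point R d -> point R d).

(** The identity counts as an involution. *)
Definition involution_on W u :=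
  [/\ forall x, ~ W x -> u x = x, forall x, u (u x) = x & pwtrans u].

Lemma involution_on_rec W u : involution_on W u -> rec_on W u.
Proof. by move=> [o uu p]; split=> //; exists u. Qed.

Lemma involution_on_sub W X u :
  (forall x, W x -> X x) -> involution_on W u -> involution_on X u.
Proof. by move=> sWX [o i p]; split=> // x nX; apply: o => /sWX. Qed.

(** Glue [f] on [X], its inverse on the image of [X], and the identity elsewhere; disjointness of
    [X] from its image makes this an involution. *)
Lemma flip_exists X f : rset X -> pwtrans f ->
  (forall x y, X x -> X y -> f x = f y -> x = y) ->
  (forall x, X x -> ~ X (f x)) ->
  exists u, [/\ pwtrans u, forall x, u (u x) = x, forall x, X x -> u x = f x
    & forall y, ~ X y -> (forall x, X x -> f x <> y) -> u y = y].
Proof.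
move=> rX pf inj dis; have [g [pg gf rfX]] := pwtrans_partial_inverse rX pf inj.
set fX := (fun y => exists2 x, X x & f x = y) in rfX.
pose u x := if `[<X x>] then f x else if `[<fX x>] then g x else x.
have uX x : X x -> u x = f x by move=> Xx; rewrite /u asboolT.
have ufX x : X x -> u (f x) = x.
  move=> Xx; rewrite /u asboolF; last exact: dis.
  by rewrite asboolT ?gf //; exists x.
have uo y : ~ X y -> (forall x, X x -> f x <> y) -> u y = y.
  by move=> nX nf; rewrite /u !asboolF // => -[x Xx]; apply: nf.
exists u; split=> //.
  by apply: pwtrans_if => //; apply: pwtrans_if => //; apply: pwtrans_id.
move=> x; have [Xx|nX] := pselect (X x); first by rewrite (uX x) // ufX.
have [[z Xz <-]|nf] := pselect (fX x); first by rewrite ufX // uX.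
by rewrite !(uo x) // => z Xz e; apply: nf; exists z.
Qed.

(** A nonzero [v] and its opposite pick the same nonzero coordinate, so exactly one of them is
    positive. *)
Definition lex_pos (v : point R d) :=
  if [pick i | v i != 0] is Some i then 0 < v i else false.

Lemma lex_posN (v : point R d) : v <> (fun=> 0) ->
  lex_pos (fun i => - v i) = ~~ lex_pos v.
Proof.
move=> v0; rewrite /lex_pos.
rewrite (@eq_pick _ _ (fun i => v i != 0)); last by move=> i; rewrite /= oppr_eq0.
case: pickP => [i vi|no]; first by rewrite oppr_gt0 -leNgt le_eqVlt (negbTE vi).
by case: v0; apply/funext => i; apply/eqP; have /negbFE := no i.
Qed.

(** The displacements of [u] at [x] and at [u x] are opposite, so positivity selects one point from
    each orbit of size two. *)
Lemma involution_orientation W u : involution_on W u ->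
  exists E, [/\ rset E, forall x, E x -> ~ E (u x), forall x, E x -> u x <> x
    & forall x, u x <> x -> E x \/ E (u x)].
Proof.
move=> [_ uu [C hC]]; pose v x : point R d := fun i => u x i - x i.
have vu x : v (u x) = fun i => - v x i by apply/funext => i; rewrite /v uu opprB.
have v0 x : u x <> x -> v x <> fun=> 0.
  by move=> h e; apply: h; apply/funext => i; have := congr1 (@^~ i) e; rewrite /v; lra.
have Ev x : lex_pos (v x) -> u x <> x.
  move=> h e; move: h; rewrite /lex_pos; case: pickP => // i.
  by rewrite /v e subrr eqxx.
exists (fun x => lex_pos (v x)); split=> //.
- exists C => x y xy; rewrite (_ : v x = v y) //; apply/funext => i.
  exact: hC.
- by move=> x h; rewrite vu lex_posN ?h //; apply/v0/Ev.
- move=> x /v0 h; rewrite vu lex_posN //; case: (lex_pos _); by [left|right].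
Qed.

(* Cutting every cell of [E] into two halves along the coordinate [i0]; [th]
   moves the lower half onto the upper one. *)
Lemma halving E u W (i0 : 'I_d) : rset E -> pwtrans u -> bounded W ->
  (forall x, E x -> W x) ->
  exists L th, [/\ rset L /\ (forall x, L x -> E x), pwtrans th,
    (forall x y, L x -> L y -> th x = th y -> x = y),
    (forall x, L x -> [/\ E (th x), ~ L (th x) &
        forall i, u (th x) i - th x i = u x i - x i]) &
    forall x, E x -> L x \/ exists2 y, L y & th y = x].
Proof.
move=> [CE hE] [Cu hu] [lo [hi bW]] EW.
pose D := [:: lo, hi & CE ++ Cu].
have sD x y : same_cell D x y -> same_cell CE x y /\ same_cell Cu x y.
  by move=> h; apply: same_cell_cat; apply: same_cell_sub h => p pC; rewrite !inE pC !orbT.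
have /choice[mx mxP] : forall t, exists p, lo <= t ->
    [/\ p \in D, p <= t & forall q, q \in D -> q <= t -> q <= p].
  move=> t; have [lt|lt] := leP lo t; last by exists t.
  have [|q qP] := @seq_max_le R D t; last by exists q.
  by apply/hasP; exists lo => //; rewrite mem_head.
have /choice[mn mnP] : forall t, exists p, t < hi ->
    [/\ p \in D, t < p & forall q, q \in D -> t < q -> p <= q].
  move=> t; have [lt|lt] := ltP t hi; last by exists t.
  have [|q qP] := @seq_min_gt R D t; last by exists q.
  by apply/hasP; exists hi => //; rewrite !inE eqxx orbT.
(* The nearest cuts around [x i0] are the two ends of its cell along [i0]; they do not change within
   the cell. *)
have cellE x : E x -> [/\ mx (x i0) \in D, mn (x i0) \in D, mx (x i0) <= x i0 < mn (x i0)
    & forall t, mx (x i0) <= t < mn (x i0) ->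
      [/\ forall p, p \in D -> (p <= t) = (p <= x i0), mx t = mx (x i0) & mn t = mn (x i0)]].
  move=> /EW /bW /(_ i0) /andP[xl xh].
  have [a1 a2 a3] := mxP _ xl; have [b1 b2 b3] := mnP _ xh; split=> //; first by rewrite a2.
  move=> t /andP[t1 t2].
  have e p : p \in D -> (p <= t) = (p <= x i0).
    move=> pD; apply/idP/idP => h.
      by rewrite leNgt; apply/negP => /b3 -/(_ pD) h2; move: (lt_le_trans t2 h2); rewrite ltNge h.
    by rewrite (le_trans (a3 _ pD h)).
  have tl : lo <= t by rewrite e ?mem_head.
  have th : t < hi by rewrite ltNge e ?inE ?eqxx ?orbT // -ltNge.
  have [c1 c2 c3] := mxP _ tl; have [e1 e2 e3] := mnP _ th; split=> //.
    by apply/le_anti; rewrite c3 // a3 // -e.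
  by apply/le_anti; rewrite e3 //= b3 // ltNge -e // -ltNge.
have mxn x y : E x -> same_cell D x y -> mx (y i0) = mx (x i0) /\ mn (y i0) = mn (x i0).
  move=> Ex xy; have [m1 m2 /andP[m3 m4] m5] := cellE x Ex.
  have [|] := m5 (y i0); last by [].
  by rewrite -(xy i0 _ m1) m3 /= ltNge -(xy i0 _ m2) -ltNge.
pose len x := (mn (x i0) - mx (x i0)) / 2.
pose mid x := (mn (x i0) + mx (x i0)) / 2.
pose sh (s : R) x : point R d := fun i => x i + (if i == i0 then s else 0).
pose th x := if `[<E x>] then sh (len x) x else x.
pose L x := E x /\ x i0 < mid x.
have shc x s : E x -> mx (x i0) <= x i0 + s < mn (x i0) -> same_cell D x (sh s x).
  move=> Ex h i p pD; rewrite /sh; case: eqP => [->|_]; last by rewrite addr0.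
  by have [_ _ _ /(_ _ h)[-> //]] := cellE x Ex.
have EsD x y : same_cell D x y -> E x -> E y by move=> /sD[/hE h _]; apply: h.
have lh x : L x -> same_cell D x (sh (len x) x).
  move=> [Ex xl]; apply: shc => //.
  by have [_ _ /andP[h1 h2] _] := cellE x Ex; move: xl; rewrite /mid /len; lra.
have thE x : E x -> th x = sh (len x) x by move=> Ex; rewrite /th asboolT.
have lenE x y : E x -> same_cell D x y -> len y = len x.
  by move=> Ex xy; rewrite /len; have [-> ->] := mxn x y Ex xy.
have midE x y : E x -> same_cell D x y -> mid y = mid x.
  by move=> Ex xy; rewrite /mid; have [-> ->] := mxn x y Ex xy.
exists L, th; split.
- split; last by move=> x [].
  (* Every midpoint of a cell is among the averages of two cuts, so these added cuts separate the
     halves. *)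
  exists (D ++ [seq (p + q) / 2 | p <- D, q <- D]) => x y /same_cell_cat[a b] [Ex xl].
  split; first exact: EsD a Ex.
  rewrite (midE x) // ltNge -b -?ltNge //; have [m1 m2 _ _] := cellE x Ex.
  exact: (allpairs_f (fun p q => (p + q) / 2)).
- exists D => x y xy i; have [Ex|nE] := pselect (E x); last first.
    rewrite /th !asboolF ?subrr // => Ey; apply: nE.
    exact: EsD (same_cell_sym xy) Ey.
  have Ey := EsD _ _ xy Ex.
  by rewrite !thE // /sh (lenE x y) //; ring.
- move=> x y Lx Ly e; have [[Ex _] [Ey _]] := (Lx, Ly).
  rewrite !thE // in e; have h := lh x Lx; have h' := lh y Ly.
  have l : len x = len y by rewrite -(lenE x _ Ex h) -(lenE y _ Ey h') e.
  by apply/funext => i; have := congr1 (@^~ i) e; rewrite /sh l => /addIr.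
- move=> x Lx; have [Ex xl] := Lx; have h := lh x Lx.
  rewrite thE //; split; first exact: EsD h Ex.
    move=> [_]; rewrite (midE x _ Ex h) /sh eqxx /mid /len => xl2.
    by have [_ _ /andP[h1 h2] _] := cellE x Ex; lra.
  by move=> i; apply/esym/hu; case: (sD _ _ h).
- move=> x Ex; have [xl|xl] := ltP (x i0) (mid x); first by left.
  right; have [_ _ /andP[h1 h2] _] := cellE x Ex.
  have h : same_cell D x (sh (- len x) x).
    by apply: shc => //; move: xl; rewrite /mid /len; lra.
  exists (sh (- len x) x).
    split; first exact: EsD h Ex.
    by rewrite (midE x _ Ex h) /sh eqxx /mid /len; lra.
  rewrite thE; last exact: EsD h Ex.
  by rewrite (lenE x _ Ex h); apply/funext => i; rewrite /sh; case: eqP => _; ring.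
Qed.

(* If [a] exchanges the lower halves of [E] and [u E] and [b] exchanges the
   lower halves with the upper ones, then [b a b] exchanges the upper halves,
   so that [u = a (b a b)]. *)
Lemma involution_commutator W u : (0 < d)%N -> bounded W -> involution_on W u ->
  exists a b, [/\ involution_on W a, involution_on W b & u \o (b \o a) = a \o b].
Proof.
move=> d0 bW iu; have [ou uu pu] := iu.
have [E [rE EuE Eu EV]] := involution_orientation iu.
have EW x : E x -> W x.
  by move=> /Eu ux; have [//|nW] := pselect (W x); case: ux; apply: ou.
have [L [th [[rL LE] pth injth thP EL]]] := halving (Ordinal d0) rE pu bW EW.
have uth x i : L x -> u (th x) i - th x i = u x i - x i by move=> /thP[].
have Eth x : L x -> E (th x) by case/thP.
have Lth x : L x -> ~ L (th x) by case/thP.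
have [||a [pa aa aL ao]] := flip_exists rL pu.
- by move=> x y _ _ /(congr1 u); rewrite !uu.
- by move=> x /LE /EuE h /LE.
(* [X] consists of the lower halves of both E and u E; on the second one, [f] is [th] conjugated by
   [u]. *)
pose X x := L x \/ L (u x).
pose f x := if `[<L x>] then th x else u (th (u x)).
have rX : rset X by apply: rsetU => //; apply: rset_preim.
have pf : pwtrans f.
  apply: pwtrans_if => //; apply: (@pwtrans_comp R d u (fun x => th (u x))) => //.
  exact: pwtrans_comp.
have fL x : L x -> f x = th x by move=> h; rewrite /f asboolT.
have nLu x : L x -> ~ L (u x) by move=> /LE /EuE h /LE.
have fu x : L x -> f (u x) = u (th x).
  by move=> h; rewrite /f asboolF ?uu //; apply: nLu.
have nEX x : E x -> ~ L x -> ~ X x.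
  by move=> Ex nL [//|/LE]; apply: EuE.
have nEX' x : E x -> ~ L x -> ~ X (u x).
  by move=> Ex nL [/LE|]; [apply: EuE|rewrite uu].
have ux_inj x y : u x = u y -> x = y by move=> /(congr1 u); rewrite !uu.
have [||b [pb bb bX bo]] := flip_exists rX pf.
- have cross x y : L x -> L (u y) -> f x <> f y.
    move=> Lx Ly; rewrite fL // -(uu y) fu // => e.
    by apply: (EuE _ (Eth _ Ly)); rewrite -e; apply: Eth.
  move=> x y [Lx|Lx] [Ly|Ly].
  + by rewrite !fL //; apply: injth.
  + by move/cross; case.
  + by move/esym/cross; case.
  + by rewrite -{1}(uu x) -{1}(uu y) !fu // => /ux_inj /(injth _ _ Lx Ly) /ux_inj.
- move=> x [Lx|Lx]; first by rewrite fL //; apply: nEX; [apply: Eth|apply: Lth].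
  by rewrite -(uu x) fu //; apply: nEX'; [apply: Eth|apply: Lth].
have aE x : E x -> ~ L x -> a x = x.
  by move=> Ex nL; apply: ao => // y Ly e; apply: (EuE _ (LE _ Ly)); rewrite e.
have auE x : E x -> ~ L x -> a (u x) = u x.
  move=> Ex nL; apply: ao => [/LE|y Ly /ux_inj e]; first exact: EuE.
  by apply: nL; rewrite -e.
have an x : u x = x -> a x = x.
  move=> e; apply: ao => [/LE/Eu//|y Ly e'].
  by have /Eu := LE _ Ly; rewrite -e' uu in e; rewrite -e.
have bn x : u x = x -> b x = x.
  move=> e; apply: bo => [[/LE/Eu//|]|y [Ly|Ly] e']; first by rewrite e => /LE/Eu.
    by rewrite fL // in e'; rewrite -e' in e; apply: (Eu _ (Eth _ Ly)).
  rewrite -(uu y) fu // in e'; rewrite -e' uu in e.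
  exact: (Eu _ (Eth _ Ly)).
have nW x : ~ W x -> u x = x by apply: ou.
exists a, b; split=> //.
- by split=> // x /nW; apply: an.
- by split=> // x /nW; apply: bn.
have bL x : L x -> b x = th x by move=> Lx; rewrite bX ?fL //; left.
have buL x : L x -> b (u x) = u (th x) by move=> Lx; rewrite bX ?fu //; right; rewrite uu.
have bth x : L x -> b (th x) = x by move=> Lx; rewrite -bL.
have buth x : L x -> b (u (th x)) = u x by move=> Lx; rewrite -buL.
apply/funext => x /=.
(* Each moved orbit meets [E], so the identity is checked at [y] and [u y], for [y] in the lower
   half or equal to some [th z]. *)
have key y : E y -> u (b (a y)) = a (b y) /\ u (b (a (u y))) = a (b (u y)).
  move=> Ey; have [Ly|[z Lz <-]] := EL _ Ey.
    have auy : a (u y) = y by rewrite -(aL y) // aa.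
    by rewrite auy aL // buL // bL // uu aE ?auE //; [apply: Eth|apply: Lth|apply: Eth|apply: Lth].
  have [Et Lt] := (Eth _ Lz, Lth _ Lz).
  by rewrite aE // auE // bth // buth // uu -(aL z) // aa.
have [ux|ux] := pselect (u x = x); first by rewrite (an x) // (bn x) // ux an.
by have [/key[] //|/key[_]] := EV _ ux; rewrite uu.
Qed.

End Involutions.

(** * The subgroup generated by involutions *)

Section GeneratedByInvolutions.
Variables (R : realType) (d : nat).
Implicit Types (x y : point R d) (X W M B : point R d -> Prop).
Implicit Types (f g h k u a b s c : point R d -> point R d).

Inductive invgen W : (point R d -> point R d) -> Prop :=
| invgen_id : invgen W id
| invgen_cons u f : involution_on W u -> invgen W f -> invgen W (u \o f).

Lemma invgen_involution W u : involution_on W u -> invgen W u.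
Proof. by move=> iu; apply: (@invgen_cons W u id) => //; apply: invgen_id. Qed.

Lemma invgen_rec W f : invgen W f -> rec_on W f.
Proof.
elim=> [|u {}f iu _ rf]; first exact: rec_on_id.
by apply: rec_on_comp => //; apply: involution_on_rec.
Qed.

Lemma invgen_comp W f g : invgen W f -> invgen W g -> invgen W (f \o g).
Proof.
by elim=> [|u {}f iu _ IH] // ig; apply: (@invgen_cons W u (f \o g)) => //; apply: IH.
Qed.

Lemma invgen_inv W f : invgen W f -> exists g, [/\ invgen W g, cancel f g & cancel g f].
Proof.
elim=> [|u {}f iu _ [g [ig fg gf]]]; first by exists id; split=> //; apply: invgen_id.
have [_ uu _] := iu; exists (g \o u); split.
- exact/invgen_comp/invgen_involution.
- exact: can_comp.
- exact: can_comp.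
Qed.

Lemma invgen_conj W f h k : rec_on W h -> cancel h k -> cancel k h ->
  invgen W f -> invgen W (h \o f \o k).
Proof.
move=> rh hk kh; have rk := rec_on_inv rh hk kh; elim=> [|u {}f iu _ IH].
  by rewrite (_ : _ \o k = id); [apply: invgen_id|apply/funext => x; apply: kh].
have -> : h \o (u \o f) \o k = (h \o u \o k) \o (h \o f \o k).
  by apply/funext => x /=; rewrite hk.
apply: invgen_cons => //; have [ou uu pu] := iu; split.
- by move=> x nx; have [ok _ _] := rk; rewrite /= ok // ou // -{1}(ok x nx) kh.
- by move=> x /=; rewrite hk uu kh.
- by apply: pwtrans_comp; [apply: pwtrans_comp => //; case: rh|case: rk].
Qed.

Lemma invgen_subgroup W : is_subgroup (invgen W).
Proof.
split; first exact: invgen_id.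
split=> [f g|f /invgen_inv[g [ig fg gf]]]; first exact: invgen_comp.
by exists g; split=> //; split; apply/funext.
Qed.

Lemma invgen_derived W : (0 < d)%N -> bounded W ->
  subset_of (invgen W) (derived (rec_on W)).
Proof.
move=> d0 bW f If H [Hid [Hc _]] _ HC; elim: If => // u {}f iu _ Hf.
apply: Hc => //; apply: HC.
have [a [b [ia ib e]]] := involution_commutator d0 bW iu.
by exists a, b; split; [|split=> //]; apply: involution_on_rec.
Qed.

Lemma derived_rec W : subset_of (derived (rec_on W)) (rec_on W).
Proof.
move=> f Df; apply: Df => //; first exact: rec_on_subgroup.
move=> c [a [b [ra [rb e]]]].
have [_ [a' [aa' a'a]] _] := ra; have [_ [b' [bb' b'b]] _] := rb.
have -> : c = a \o b \o (a' \o b').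
  by apply/funext => x; rewrite -e /= a'a b'b.
apply: rec_on_comp; apply: rec_on_comp => //; [exact: rec_on_inv ra _ _|exact: rec_on_inv rb _ _].
Qed.

Lemma commute_on X f g : (forall x, X x -> X (f x)) -> (forall x, ~ X x -> f x = x) ->
  (forall x, X x -> g x = x) -> (forall x, ~ X x -> ~ X (g x)) ->
  forall x, f (g x) = g (f x).
Proof.
move=> mf of_ og mg x; have [Xx|nX] := pselect (X x).
  by rewrite (og _ Xx) og //; apply: mf.
by rewrite (of_ _ nX) of_ //; apply: mg.
Qed.

(** Congruence modulo [invgen W], which is normal in [rec_on W] by [invgen_conj]. *)
Definition same_class W f g := exists2 a, invgen W a & forall x, f x = a (g x).

Lemma same_class_sym W f g : same_class W f g -> same_class W g f.
Proof.
move=> [a /invgen_inv[b [ib ab _]] e]; exists b => // x.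
by rewrite e ab.
Qed.

Lemma same_class_trans W f g h :
  same_class W f g -> same_class W g h -> same_class W f h.
Proof.
move=> [a ia e] [b ib e']; exists (a \o b); first exact: invgen_comp.
by move=> x; rewrite e e'.
Qed.

Lemma same_class_comp W f f' g g' : rec_on W f' ->
  same_class W f f' -> same_class W g g' -> same_class W (f \o g) (f' \o g').
Proof.
move=> rf' [a ia e] [b ib e']; have [_ [k [fk kf]] _] := rf'.
exists (a \o (f' \o b \o k)).
  by apply: invgen_comp => //; apply: invgen_conj.
by move=> x /=; rewrite e e' fk.
Qed.

(* Modulo [invgen M], f and g are represented by elements supported in B, and
   conjugating one of these by s makes their supports disjoint. *)
Lemma commutator_invgen M B s f g a b c : involution_on M s ->
  (forall x, B x -> ~ B (s x)) -> (forall x, B x -> M x) ->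
  rec_on M f -> rec_on M g -> invgen M a -> invgen M b ->
  rec_on B (a \o f) -> rec_on B (b \o g) ->
  c \o (g \o f) = f \o g -> invgen M c.
Proof.
move=> is_ sB BM rf rg ia ib rf' rg' ec.
set f' := a \o f in rf'; set g' := b \o g in rg'.
have rMf' := rec_on_sub BM rf'; have rMg' := rec_on_sub BM rg'.
have [os ss ps] := is_.
have cf : same_class M f f' by apply: same_class_sym; exists a.
have cg : same_class M g g' by apply: same_class_sym; exists b.
(* The support of [f''] lies in the image of [B] under [s], hence misses [B], which supports
   [g']. *)
pose f'' := s \o f' \o s.
have rf'' : rec_on M f''.
  by apply: rec_on_comp; first apply: rec_on_comp => //; apply: involution_on_rec.
have cf' : same_class M f' f''.
  apply: same_class_sym; have [_ [k [fk kf]] _] := rMf'.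
  exists (s \o (f' \o s \o k)).
    apply: invgen_comp; first exact: invgen_involution.
    by apply: invgen_conj => //; apply: invgen_involution.
  by move=> x /=; rewrite fk.
have cf2 := same_class_trans cf cf'.
have com : f'' \o g' = g' \o f''.
  apply/funext => x; apply/esym; apply: (@commute_on B g' f'').
  - by move=> y By; exact: (rec_on_maps rg' By).
  - by case: rg'.
  - by move=> y /sB nB; rewrite /f'' /=; case: rf' => -> // _ _; rewrite ss.
  - move=> y nBy; rewrite /f'' /= => Bf.
    have [By|nB] := pselect (B (s y)); first exact: sB (rec_on_maps rf' By) Bf.
    by move: Bf; case: rf' => -> // _ _; rewrite ss.
have [e ie E] : same_class M (f \o g) (g \o f).
  have h1 := same_class_comp rf'' cf2 cg; rewrite com in h1.
  apply: same_class_trans h1 _; apply: same_class_sym.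
  exact: same_class_comp.
have [_ [f1 [ff1 f1f]] _] := rf; have [_ [g1 [gg1 g1g]] _] := rg.
rewrite (_ : c = e) //; apply/funext => x.
have := congr1 (@^~ (f1 (g1 x))) ec.
by rewrite [RHS]E /= f1f g1g.
Qed.

(* For h in H the double commutator [[h, a], b] equals [a, b] as soon as h
   moves B off itself. *)
Lemma commutator_in_normalized M B (H : (point R d -> point R d) -> Prop) h a b c :
  (0 < d)%N -> bounded M ->
  is_subgroup H -> normalized_by H (derived (rec_on M)) -> H h ->
  (forall x, B x -> ~ B (h x)) -> (forall x, B x -> M x) ->
  involution_on B a -> involution_on B b -> c \o (b \o a) = a \o b -> H c.
Proof.
move=> d0 bM [Hid [Hc Hi]] Hn Hh hB BM ia ib ec.
have [k [Hk [kh hk]]] := Hi _ Hh.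
have {}kh x : k (h x) = x by rewrite -[RHS]/(id x) -kh.
have {}hk x : h (k x) = x by rewrite -[RHS]/(id x) -hk.
have conj u q : involution_on B u -> H q -> H (u \o q \o u).
  move=> iu; have [_ uu _] := iu; apply: Hn; try by apply/funext.
  by apply: invgen_derived => //; apply/invgen_involution/(involution_on_sub BM).
have [oa aa _] := ia; have [ob bb _] := ib.
have amap x (Bx : B x) := rec_on_maps (involution_on_rec ia) Bx.
have bmap x (Bx : B x) := rec_on_maps (involution_on_rec ib) Bx.
(* [p] is supported in the image of [B] under [h], off [B], hence commutes with [a] and [b]. *)
pose p := h \o a \o k.
have pp x : p (p x) = x by rewrite /p /= kh aa hk.
have pB x : B x -> p x = x.
  by move=> Bx; rewrite /p /= oa ?hk // => /hB; rewrite hk.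
have pnB x : ~ B x -> ~ B (p x).
  by move=> nB Bp; apply: (nB); rewrite -(pp x) pB.
have pa := commute_on amap oa pB pnB; have pb := commute_on bmap ob pB pnB.
(* The first factor is [[h, a] = p a], the second is its inverse [a p] conjugated by [b]. Both are
   in [H], and in the product the two [p] cancel, leaving [a b a b = c]. *)
have -> : c = (h \o (a \o k \o a)) \o (b \o ((a \o h \o a) \o k) \o b).
  apply/funext => x; rewrite -[RHS]/(p (a (b (a (p (b x)))))) pa pb pa pp.
  by have := congr1 (@^~ (a (b x))) ec; rewrite /= aa bb.
exact: (Hc _ _ (Hc _ _ Hh (conj _ _ ia Hk)) (conj _ _ ib (Hc _ _ (conj _ _ ia Hh) Hk))).
Qed.

End GeneratedByInvolutions.

(** * Finite lists and finite sets *)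

Lemma seq_lower_bound (R : realType) (s : seq R) :
  exists2 r, 0 < r & forall p, p \in s -> 0 < p -> r <= p.
Proof.
elim: s => [|a s [r r0 rs]]; first by exists 1.
have [a0|a0] := ltP 0 a.
  exists (Num.min a r); first by rewrite lt_min a0.
  by move=> p; rewrite inE ge_min => /orP[/eqP->|/rs h /h ->]; rewrite ?lexx ?orbT.
by exists r => // p; rewrite inE => /orP[/eqP->|/rs//]; rewrite ltNge a0.
Qed.

Lemma card_le_injection (T : finType) (A B : {set T}) : (#|A| <= #|B|)%N ->
  exists s : T -> T, (forall x, x \in A -> s x \in B) /\ {in A &, injective s}.
Proof.
move=> AB; exists (fun x => nth x (enum B) (index x (enum A))).
have lt x : x \in A -> (index x (enum A) < size (enum B))%N.
  by move=> xA; rewrite -cardE (leq_trans _ AB) // cardE index_mem mem_enum.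
split=> [x xA|x y xA yA]; first by rewrite -mem_enum mem_nth ?lt.
rewrite (set_nth_default y) ?lt // => /eqP.
rewrite nth_uniq ?lt ?enum_uniq // => /eqP e.
by rewrite -[x](@nth_index _ x x (enum A)) ?mem_enum // e nth_index ?mem_enum.
Qed.

(** * Grids *)

Section Grid.
Variables (R : realType) (d : nat).
Implicit Types (C : seq R) (x y o : point R d) (X W M E B : point R d -> Prop).
Implicit Types (f g u a b : point R d -> point R d) (z : 'I_d -> nat).

Definition gcell o (e : R) z :=
  in_rect (fun i => o i + (z i)%:R * e) (fun i => o i + (z i).+1%:R * e).

(** Truncation gives 0 on negative numbers, so this is the index of the cell only for points above
    [o]. *)
Definition gindex o (e : R) x : 'I_d -> nat := fun i => Num.truncn ((x i - o i) / e).

Definition block o (e : R) (N m : nat) :=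
  in_rect (fun i => o i + N%:R * e) (fun i => o i + (N + m)%:R * e).

Lemma gindex_gcell o e x z : 0 < e -> gcell o e z x -> gindex o e x = z.
Proof.
move=> e0 h; apply/funext => i; have [h1 h2] := h i; apply: truncn_def.
by rewrite ler_pdivlMr // ltr_pdivrMr //; apply/andP; split; lra.
Qed.

Lemma gcell_gindex o e x : 0 < e -> (forall i, o i <= x i) -> gcell o e (gindex o e x) x.
Proof.
move=> e0 h i; have /andP[] : (gindex o e x i)%:R <= (x i - o i) / e < (gindex o e x i).+1%:R.
  by apply: truncn_itv; rewrite divr_ge0 ?subr_ge0 // ltW.
by rewrite ler_pdivlMr // ltr_pdivrMr //; split; lra.
Qed.

Lemma gindex_lt o e x K i : 0 < e -> o i <= x i -> x i < o i + K%:R * e ->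
  (gindex o e x i < K)%N.
Proof.
move=> e0 h1 h2; rewrite /gindex truncn_lt_nat ?ltr_pdivrMr //; first by lra.
by rewrite divr_ge0 ?subr_ge0 // ltW.
Qed.

Lemma gindex_subdiv o e x k i : 0 < e -> (0 < k)%N -> o i <= x i ->
  gindex o e x i = (gindex o (e / k%:R) x i %/ k)%N.
Proof.
move=> e0 k0 h; rewrite /gindex; have kR : 0 < k%:R :> R by rewrite ltr0n.
set t := (x i - o i) / (e / k%:R).
have t0 : 0 <= t by rewrite divr_ge0 ?subr_ge0 // ltW // divr_gt0.
have -> : (x i - o i) / e = t / k%:R by rewrite /t; field; rewrite !gt_eqF.
apply: truncn_def; have /andP[h1 h2] := truncn_itv t0.
set n := Num.truncn t in h1 h2 *; have := divn_eq n k; have := ltn_pmod n k0.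
set q := (n %/ k)%N; set r := (n %% k)%N => rk nE.
rewrite ler_pdivlMr // ltr_pdivrMr // -!natrM; apply/andP; split.
  by apply: le_trans h1; rewrite ler_nat; lia.
by apply: lt_le_trans h2 _; rewrite ler_nat; lia.
Qed.

(** Take the left end of the grid interval of [x], unless a cut lies after it and not after [x]. In
    that case take the right end: the next cut is at least [e] further, so none lies between [x] and
    that end. *)
Lemma near_grid_point C (o e x : R) : 0 < e -> o <= x ->
  (forall p q, p \in C -> q \in C -> p < q -> e <= q - p) ->
  exists w : nat, - e <= o + w%:R * e - x <= e /\
    forall p, p \in C -> (p <= o + w%:R * e) = (p <= x).
Proof.
move=> e0 ox gap; pose n := Num.truncn ((x - o) / e).
have /andP[] : n%:R <= (x - o) / e < n.+1%:R.
  by apply: truncn_itv; rewrite divr_ge0 ?subr_ge0 // ltW.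
rewrite ler_pdivlMr // ltr_pdivrMr // -natr1 => h1 h2.
have [/hasP[p pC /andP[p1 p2]]|/hasPn no] :=
    boolP (has (fun p => (o + n%:R * e < p) && (p <= x)) C); last first.
  exists n; split; first by apply/andP; split; lra.
  move=> p /no; rewrite negb_and -leNgt -ltNge => /orP[h|h].
    by rewrite h; apply/esym/(le_trans h); lra.
  by apply/idP/idP => h'; lra.
exists n.+1; rewrite -natr1; split; first by apply/andP; split; lra.
move=> q qC; apply/idP/idP => h; last by lra.
by rewrite leNgt; apply/negP => xq; have := gap _ _ pC qC; lra.
Qed.

End Grid.

(** * Packing a set into a block *)

Section Packing.
Variables (R : realType) (d : nat).
Implicit Types (C : seq R) (x y o : point R d) (X W M E B : point R d -> Prop).
Implicit Types (f g u a b : point R d -> point R d) (z : 'I_d -> nat).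

Lemma gindex_close o (e : R) x y i : 0 < e -> o i <= x i -> o i <= y i ->
  x i - y i <= e -> (gindex o e x i <= (gindex o e y i).+1)%N.
Proof.
move=> e0 ox oy xy; rewrite -ltnS {1}/gindex truncn_lt_nat; last first.
  by rewrite divr_ge0 ?subr_ge0 // ltW.
have /andP[_] : (gindex o e y i)%:R <= (y i - o i) / e < (gindex o e y i).+1%:R.
  by apply: truncn_itv; rewrite divr_ge0 ?subr_ge0 // ltW.
by rewrite !ltr_pdivrMr // -[in X in _ -> X]natr1; lra.
Qed.

Lemma expn3_lt_expn4 n : (0 < n)%N -> (3 ^ n < 4 ^ n)%N.
Proof. by move=> n0; rewrite ltn_exp2r. Qed.

(* The cells of a fine subgrid that meet [f E] number at most [3 ^ d] times
   those that subdivide the coarse cell [z], while the block contains [4 ^ d]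
   times as many. So there are enough free fine cells in the block to place
   [E], fine cell by fine cell. *)
Lemma embed_in_block o (e : R) (K N : nat) M E f z :
  (0 < d)%N -> 0 < e -> (forall x, M x -> forall i, o i <= x i < o i + K%:R * e) ->
  (N + 4 <= K)%N -> rset E -> (forall x, E x -> M x) ->
  (forall x, E x -> gcell o e z x) -> rec_on M f ->
  exists k, [/\ pwtrans k, forall x y, E x -> E y -> k x = k y -> x = y,
    forall x, E x -> block o e N 4 (k x) & forall x y, E x -> E y -> k x <> f y].
Proof.
move=> d0 e0 bM NK [CE hE] EM Ez rf.
have fM x (Mx : M x) := rec_on_maps rf Mx.
have [_ _ [Cf hf]] := rf.
pose D := CE ++ Cf.
have [r r0 rP] := seq_lower_bound [seq q - p | p <- D, q <- D].
(* Since [k > e / r], the fine mesh [e / k] is below every positive gap between two cuts. *)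
pose k := (Num.truncn (e / r)).+1.
have kR : 0 < k%:R :> R by rewrite ltr0n.
pose ep := e / k%:R.
have ep0 : 0 < ep by rewrite divr_gt0.
have kep : k%:R * ep = e by rewrite /ep; field; rewrite gt_eqF.
have epr : ep <= r.
  rewrite /ep ler_pdivrMr // mulrC -ler_pdivrMr //.
  by have /andP[_ /ltW] := truncn_itv (divr_ge0 (ltW e0) (ltW r0)).
have gap p q : p \in D -> q \in D -> p < q -> ep <= q - p.
  move=> pD qD pq; apply: le_trans epr _; apply: rP; last by rewrite subr_gt0.
  exact: (allpairs_f (fun p q => q - p)).
pose L := (K * k)%N.
(* [L] fine cells per axis cover [M]; the successor serves [inord]. *)
pose T := {ffun 'I_d -> 'I_L.+1}.
pose cx x : T := [ffun i => inord (gindex o ep x i)].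
have Mo x : M x -> forall i, o i <= x i by move=> Mx i; have /andP[] := bM _ Mx i.
have cxP x : M x -> forall i, cx x i = gindex o ep x i :> nat.
  move=> Mx i; rewrite ffunE inordK // ltnS ltnW //.
  have /andP[h1 h2] := bM _ Mx i; apply: gindex_lt => //.
  by rewrite /L natrM -mulrA kep.
have cxc x : M x -> gcell o ep (fun i => cx x i) x.
  move=> Mx; rewrite (_ : (fun i => _) = gindex o ep x); last exact/funext/cxP.
  exact/gcell_gindex/Mo.
have cxE x : E x -> forall i, (cx x i %/ k)%N = z i.
  move=> Ex i; have Mx := EM _ Ex.
  by rewrite cxP // -gindex_subdiv ?Mo // (gindex_gcell e0 (Ez _ Ex)).
pose corner (c : T) : point R d := fun i => o i + (c i)%:R * ep.
(* Fine cells: [V] those subdividing the coarse cell [z], [W] those of the block, [Z] those met by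
   the image of [E]. *)
pose V := [set c : T | [forall i, (c i %/ k)%N == z i]].
pose W := [set c : T | [forall i, (N <= c i %/ k) && (c i %/ k < N + 4)]%N].
pose Z := [set c : T | `[<exists2 x, E x & cx (f x) = c>]].
have cxV x : E x -> cx x \in V.
  by move=> Ex; rewrite inE; apply/forallP => i; rewrite cxE.
(* Each point of [E] shares its cell for the cuts [D] with a nearby fine corner, so [f] moves both
   by the same vector and the images stay within [ep]. *)
have near x : E x -> exists w : T, [/\ w \in V, E (corner w) &
    forall i, f (corner w) i - f x i = corner w i - x i /\ - ep <= corner w i - x i <= ep].
  move=> Ex; have Mx := EM _ Ex.
  have /choice[w wP] : forall i, exists n : nat, - ep <= o i + n%:R * ep - x i <= ep /\
      forall p, p \in D -> (p <= o i + n%:R * ep) = (p <= x i).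
    by move=> i; apply: near_grid_point => //; apply: Mo.
  pose y : point R d := fun i => o i + (w i)%:R * ep.
  have /same_cell_cat[sE sf] : same_cell D x y by move=> i p /((wP i).2 p)->.
  have Ey : E y by apply: hE Ex.
  have yE : corner (cx y) = y.
    apply/funext => i; rewrite /corner cxP; last exact: EM.
    rewrite (@gindex_gcell R d o ep y w) // => j; rewrite /y -natr1.
    by split; lra.
  exists (cx y); rewrite yE; split=> //; first exact: cxV.
  by move=> i; split; [have := hf _ _ sf i; lra|have [] := wP i].
have cardZ : (#|Z| <= #|V| * 3 ^ d)%N.
  (* A cell of [Z] is at most one step per axis from the cell of some [f (corner w)]; the offsets 0,
     1, 2 encode the steps -1, 0, 1. *)
  pose g (p : T * {ffun 'I_d -> 'I_3}) : T :=
    [ffun i => inord (cx (f (corner p.1)) i + p.2 i - 1)].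
  have sub : Z \subset [set g p | p in setX V setT].
    apply/subsetP => c; rewrite inE => /asboolP[x Ex <-].
    have [w [wV Ew wP]] := near x Ex.
    have [Mf Mfw] : M (f x) /\ M (f (corner w)) by split; apply/fM/EM.
    apply/imsetP; exists (w, [ffun i => inord (cx (f x) i + 1 - cx (f (corner w)) i)]).
      by rewrite in_setX wV inE.
    apply/ffunP => i; rewrite [RHS]ffunE /=.
    have [w1 /andP[w2 w3]] := wP i.
    have h1 : (cx (f x) i <= (cx (f (corner w)) i).+1)%N.
      by rewrite !cxP //; apply: gindex_close; rewrite ?Mo //; lra.
    have h2 : (cx (f (corner w)) i <= (cx (f x) i).+1)%N.
      by rewrite !cxP //; apply: gindex_close; rewrite ?Mo //; lra.
    rewrite (ffunE (fun i => inord (cx (f x) i + 1 - cx (f (corner w)) i) : 'I_3) i).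
    rewrite inordK; last by lia.
    by rewrite -[LHS]inord_val; congr inord; lia.
  apply: leq_trans (subset_leq_card sub) _; apply: leq_trans (leq_imset_card _ _) _.
  by rewrite cardsX cardsT card_ffun !card_ord.
have cardW : (#|V| * 4 ^ d <= #|W|)%N.
  (* Copy a fine cell of [z], keeping its position modulo [k], into each of the [4 ^ d] coarse cells
     of the block. *)
  pose g (p : T * {ffun 'I_d -> 'I_4}) : T :=
    [ffun i => inord (k * (N + p.2 i) + p.1 i %% k)].
  have gE p i : g p i = (k * (N + p.2 i) + p.1 i %% k)%N :> nat.
    rewrite ffunE inordK // /L; have := ltn_pmod (p.1 i) (isT : (0 < k)%N).
    by have := ltn_ord (p.2 i); move: NK; nia.
  have gdiv p i : (g p i %/ k)%N = (N + p.2 i)%N.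
    by rewrite gE mulnC divnMDl // divn_small ?addn0 // ltn_pmod.
  have gmod p i : (g p i %% k)%N = (p.1 i %% k)%N.
    by rewrite gE mulnC modnMDl modn_mod.
  have -> : (#|V| * 4 ^ d)%N = #|[set g p | p in setX V setT]|.
    rewrite card_in_imset; first by rewrite cardsX cardsT card_ffun !card_ord.
    move=> [w s] [w' s']; rewrite !in_setX !inE !andbT /= => /forallP wV /forallP wV' e1.
    congr pair; apply/ffunP => i; apply: val_inj => /=.
      have := gmod (w, s) i; rewrite e1 gmod /= => e2.
      by rewrite (divn_eq (w i) k) (divn_eq (w' i) k) (eqP (wV i)) (eqP (wV' i)) e2.
    by have := gdiv (w, s) i; rewrite e1 gdiv /= => /addnI.
  apply/subset_leq_card/subsetP => c /imsetP[p _ ->]; rewrite inE; apply/forallP => i.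
  by rewrite gdiv leq_addr ltn_add2l ltn_ord.
have cardVW : (#|V| <= #|W :\: Z|)%N.
  have := cardsID Z W; have := subset_leq_card (subsetIr W Z).
  have := expn3_lt_expn4 d0; nia.
have [s [sW sI]] := card_le_injection cardVW.
(* Each fine cell is translated onto the free cell that [s] assigns to it. *)
pose kp x : point R d := fun i => x i + ((s (cx x) i)%:R - (cx x i)%:R) * ep.
pose kk x := if `[<E x>] then kp x else x.
have kkE x : E x -> kk x = kp x by move=> Ex; rewrite /kk asboolT.
have kc x : E x -> gcell o ep (fun i => s (cx x) i) (kk x).
  move=> Ex i; rewrite kkE // /kp.
  by have [] := cxc _ (EM _ Ex) i; rewrite /= -!natr1; split; lra.
have kidx x : E x -> gindex o ep (kk x) = fun i => s (cx x) i.
  by move=> Ex; apply: gindex_gcell => //; apply: kc.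
exists kk; split.
(* All grid lines become cuts, up to the line [L.+1] that bounds a cell of index [L]. *)
- exists (D ++ [seq o i + m%:R * ep | i <- enum 'I_d, m <- iota 0 L.+2]) => x y.
  move=> /same_cell_cat[/same_cell_cat[sE _] sg] i.
  have [Ex|nE] := pselect (E x); last first.
    rewrite /kk !asboolF ?subrr // => Ey; apply: nE; apply: hE Ey.
    exact: same_cell_sym.
  have Ey := hE _ _ sE Ex; rewrite !kkE // /kp.
  suff -> : cx y = cx x by ring.
  apply/ffunP => j; apply: val_inj => /=; rewrite !cxP; try exact: EM.
  have Mx := EM _ Ex; have [l1 l2] := cxc _ Mx j.
  have gm m : (m < L.+2)%N -> (o j + m%:R * ep <= x j) = (o j + m%:R * ep <= y j).
    move=> mL; apply: sg; apply: (allpairs_f (fun i m => o i + m%:R * ep)).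
      by rewrite mem_enum.
    by rewrite mem_iota.
  have h1 : o j + (cx x j)%:R * ep <= y j by rewrite -gm // (ltn_trans (ltn_ord _)).
  have lt : ((cx x j).+1 < L.+2)%N by rewrite ltnS ltn_ord.
  have h2 : y j < o j + (cx x j).+1%:R * ep by rewrite ltNge -gm // -ltNge.
  rewrite -(cxP x) // /gindex; apply: truncn_def.
  by rewrite ler_pdivlMr // ltr_pdivrMr //; apply/andP; split; lra.
- move=> x y Ex Ey e1.
  have sxy : s (cx x) = s (cx y).
    apply/ffunP => i; apply: val_inj => /=.
    by rewrite -[LHS]/((fun i => s (cx x) i : nat) i) -kidx // e1 kidx.
  have cxy : cx x = cx y by apply: sI => //; apply: cxV.
  apply/funext => i; have := congr1 (@^~ i) e1; rewrite !kkE // /kp cxy; exact: addIr.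
- move=> x Ex i; have := sW _ (cxV _ Ex); rewrite !inE => /andP[_ /forallP /(_ i)].
  set m := s (cx x) i => /andP[h1 h2]; have [l1 l2] := kc _ Ex i.
  have h3 : (N * k <= m)%N by rewrite -leq_divRL.
  have h4 : (m.+1 <= (N + 4) * k)%N by rewrite -ltn_divLR.
  have {}h3 : N%:R * e <= m%:R * ep by rewrite -kep mulrA -natrM ler_pM2r // ler_nat.
  have {}h4 : m.+1%:R * ep <= (N + 4)%:R * e by rewrite -kep mulrA -natrM ler_pM2r // ler_nat.
  by split; lra.
- move=> x y Ex Ey e1; have := sW _ (cxV _ Ex); rewrite !inE => /andP[/negP nZ _].
  apply: nZ; apply/asboolP; exists y => //; apply/ffunP => i; apply: val_inj => /=.
  rewrite cxP; last exact/fM/EM.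
  by rewrite -e1 kidx.
Qed.

End Packing.

(** * Reduction to a block, and generation of the derived subgroup by involutions *)

Section Reduction.
Variables (R : realType) (d : nat).
Implicit Types (C : seq R) (x y o : point R d) (X W M E B : point R d -> Prop).
Implicit Types (f g u a b h : point R d -> point R d) (z : 'I_d -> nat).

Lemma rset_fixpoints f : pwtrans f -> rset (fun x => f x = x).
Proof.
move=> [C hC]; exists C => x y xy e; apply/funext => i.
by have := hC _ _ xy i; rewrite e; lra.
Qed.

Lemma grid_cover o (e : R) K x : 0 < e -> (forall i, o i <= x i < o i + K%:R * e) ->
  exists z : {ffun 'I_d -> 'I_K}, gcell o e (fun i => z i) x.
Proof.
move=> e0 h; have lt i : (gindex o e x i < K)%N.
  by have /andP[h1 h2] := h i; apply: gindex_lt.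
exists [ffun i => Ordinal (lt i)].
rewrite (_ : (fun i => _) = gindex o e x); last by apply/funext => i; rewrite ffunE.
by apply: gcell_gindex => // i; have /andP[] := h i.
Qed.

(** Induction over the coarse cells. At each one, [E] collects the points outside the block that are
    still moved; [u] exchanges f1 E with k E, and [v] exchanges k E with E. Points outside the block
    that are already fixed avoid all three sets, so they stay fixed. *)
Lemma reduce_to_block o (e : R) (K N : nat) M f :
  (0 < d)%N -> 0 < e -> rset M ->
  (forall x, M x -> forall i, o i <= x i < o i + K%:R * e) ->
  (N + 4 <= K)%N -> (forall x, block o e N 4 x -> M x) -> rec_on M f ->
  exists2 a, invgen M a & rec_on (block o e N 4) (a \o f).
Proof.
move=> d0 e0 rM bM NK BM rf; set B := block o e N 4.
suff [a ia aP] : exists2 a, invgen M a & forall x, M x -> ~ B x -> a (f x) = x.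
  exists a => //; have [oaf iaf paf] := rec_on_comp (invgen_rec ia) rf; split=> // x nB.
  by have [Mx|nM] := pselect (M x); [apply: aP|apply: oaf].
suff [a ia aP] : exists2 a, invgen M a & forall x, M x -> ~ B x ->
    (exists2 z, z \in enum {ffun 'I_d -> 'I_K} & gcell o e (fun i => z i) x) -> a (f x) = x.
  exists a => // x Mx nB; apply: aP => //.
  by have [z zx] := grid_cover e0 (bM _ Mx); exists z; rewrite ?mem_enum.
elim: (enum _) => [|z s [a ia aP]].
  by exists id; [apply: invgen_id|move=> x _ _ []].
pose f1 := a \o f.
have rf1 : rec_on M f1 by apply: rec_on_comp => //; apply: invgen_rec.
have [_ [g1 [fg1 gf1]] pf1] := rf1.
have pg1 : pwtrans g1 by have [] := rec_on_inv rf1 fg1 gf1.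
pose E x := M x /\ (~ B x /\ (gcell o e (fun i => z i) x /\ f1 x <> x)).
have rE : rset E.
  apply: rsetI => //; apply: rsetI; first exact/rsetC/rset_rect.
  by apply: rsetI; [apply: rset_rect|apply/rsetC/rset_fixpoints].
have EM x : E x -> M x by case.
have EB x : E x -> ~ B x by case=> _ [].
have Ez x : E x -> gcell o e (fun i => z i) x by move=> [_ [_ []]].
have [k [pk kI kB kf]] := embed_in_block d0 e0 bM NK rE EM Ez rf1.
have [|v [pv vv vE vo]] := flip_exists rE pk kI.
  by move=> x /kB kx /EB.
pose X1 y := E (g1 y).
have [||||u [pu uu uE uo]] := @flip_exists _ _ X1 (k \o g1).
- exact: rset_preim.
- exact: pwtrans_comp.
- by move=> x y Xx Xy /(kI _ _ Xx Xy) /(can_inj gf1).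
- by move=> y Xy X'; apply: (kf _ _ Xy X'); rewrite gf1.
have nM y : ~ M y -> u y = y /\ v y = y.
  move=> nMy; split; [apply: uo|apply: vo] => [X|x X e1|X|x X e1]; apply: nMy.
  - by rewrite -(gf1 y); apply/(rec_on_maps rf1)/EM.
  - by rewrite -e1; apply/BM/kB.
  - exact: EM.
  - by rewrite -e1; apply/BM/kB.
exists (v \o (u \o a)).
  apply: invgen_cons; first by split=> // y /nM[].
  by apply: invgen_cons => //; split=> // y /nM[].
move=> x Mx nB zx; rewrite /= -[a (f x)]/(f1 x).
have fixP : f1 x = x -> v (u (f1 x)) = x.
  move=> e1; rewrite e1 uo; first apply: vo.
  - by case=> _ [_ []].
  - by move=> y Ey e2; apply: nB; rewrite -e2; apply: kB.
  - by rewrite /X1 -{1}e1 fg1 => -[_ [_ []]].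
  - by move=> y Ey e2; apply: nB; rewrite -e2; apply: kB.
have [/fixP //|ne] := pselect (f1 x = x).
have Ex : E x.
  split=> //; split=> //; split=> //.
  case: zx => z'; rewrite inE => /orP[/eqP-> //|z's zx].
  by case: ne; apply: aP => //; exists z'.
rewrite uE; last by rewrite /X1 fg1.
by rewrite /= fg1 -(vE _ Ex) vv.
Qed.

(** Cells are closed from below, so a small enough cube with lower corner [x] stays in the cell of
    [x]. *)
Lemma cube_same_cell C x : exists2 r, 0 < r &
  forall y, (forall i, x i <= y i < x i + r) -> same_cell C x y.
Proof.
have [r r0 rP] := seq_lower_bound [seq p - x i | p <- C, i <- enum 'I_d].
exists r => // y xy i p pC; have /andP[h1 h2] := xy i.
apply/idP/idP => h; first exact: le_trans h h1.
rewrite leNgt; apply/negP => xp; have := rP (p - x i); rewrite subr_gt0 => /(_ _ xp).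
suff -> : p - x i \in [seq p - x i | p <- C, i <- enum 'I_d] by move/(_ isT); lra.
by apply: (allpairs_f (fun p i => p - x i)); rewrite ?mem_enum.
Qed.

(** The origin is [x0] lowered by [N] steps on every axis. Eight cells from [x0] leave room for a
    block of four and its translate by four. *)
Lemma grid_exists M x0 (eta tau : R) : bounded M -> 0 < eta -> 0 < tau ->
  exists o e K N, [/\ 0 < e, e <= tau, 8%:R * e <= eta,
    forall x, M x -> forall i, o i <= x i < o i + K%:R * e &
    (N + 8 <= K)%N /\ forall i, x0 i = o i + N%:R * e].
Proof.
move=> [lo [hi bM]] eta0 tau0.
pose e := Num.min tau (eta / 8%:R).
have e0 : 0 < e by rewrite lt_min tau0 divr_gt0.
have small (s : 'I_d -> R) : exists n : nat, forall i, s i <= n%:R * e.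
  exists (\sum_i (Num.truncn (`|s i| / e)).+1)%N => i.
  rewrite -ler_pdivrMr //; have /andP[_ h] := truncn_itv (divr_ge0 (normr_ge0 (s i)) (ltW e0)).
  apply: (@le_trans _ _ (`|s i| / e)); first by rewrite ler_pM2r ?invr_gt0 ?ler_norm.
  by apply: le_trans (ltW h) _; rewrite ler_nat (bigD1 i) //= leq_addr.
have [N NP] := small (fun i => x0 i - lo).
pose o : point R d := fun i => x0 i - N%:R * e.
have [L LP] := small (fun i => hi - o i).
exists o, e, (L + (N + 8))%N, N; split=> //.
- by rewrite /e ge_min lexx.
- by rewrite mulrC -ler_pdivlMr // /e ge_min lexx orbT.
- move=> x Mx i; have /andP[h1 h2] := bM _ Mx i.
  have h3 : 0 <= (N + 8)%:R * e by rewrite mulr_ge0 // ltW.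
  have := NP i; have := LP i; rewrite natrD mulrDl => h4 h5.
  by apply/andP; split; [rewrite /o; lra|lra].
- by split=> [|i]; [rewrite leq_addl|rewrite /o; ring].
Qed.

Lemma bounded_sub X M : (forall x, X x -> M x) -> bounded M -> bounded X.
Proof. by move=> XM [lo [hi b]]; exists lo, hi => x /XM /b. Qed.

Definition cube x (r : R) y := forall i, x i <= y i < x i + r.

(** The derived subgroup lies in every subgroup containing the commutators, so only commutators are
    examined; [s] exchanges the block with its diagonal neighbour. *)
Lemma derived_invgen M : (0 < d)%N -> rset M -> bounded M -> (exists x, M x) ->
  subset_of (derived (rec_on M)) (invgen M).
Proof.
move=> d0 rM bM [x0 Mx0]; have [CM hM] := rM.
have [r r0 rP] := cube_same_cell CM x0.
have QM y : cube x0 r y -> M y by move=> /rP h; apply: hM h Mx0.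
have [o [e [K [N [e0 _ er bK [NK x0E]]]]]] := grid_exists x0 bM r0 r0.
have NK4 : (N + 4 <= K)%N by lia.
have BM y : block o e N 4 y -> M y.
  move=> By; apply: QM => i; have [] := By i; rewrite natrD mulrDl x0E => h1 h2.
  by apply/andP; split; lra.
pose t : point R d := fun=> 4%:R * e.
have BtM y : block o e N 4 y -> M (translate t y).
  move=> By; apply: QM => i; have [] := By i; rewrite natrD mulrDl x0E /translate /t => h1 h2.
  by apply/andP; split; lra.
have Bt y : block o e N 4 y -> ~ block o e N 4 (translate t y).
  move=> /(_ (Ordinal d0)) [+ _] /(_ (Ordinal d0)) [_].
  by rewrite natrD mulrDl /translate /t; lra.
have [|s [ps ss sB so]] := flip_exists (rset_rect _ _) (pwtrans_translate t) _ Bt.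
  by move=> x y _ _ e1; apply/funext => i; have := congr1 (@^~ i) e1; rewrite /translate; lra.
move=> f Df; apply: Df; first exact: invgen_subgroup.
  by move=> g; apply: invgen_rec.
move=> c [a [b [ra [rb ec]]]].
have [a' ia' ra'] := reduce_to_block d0 e0 rM bK NK4 BM ra.
have [b' ib' rb'] := reduce_to_block d0 e0 rM bK NK4 BM rb.
apply: (@commutator_invgen _ _ M (block o e N 4) s a b a' b') => //.
  split=> // y nM; apply: so => [/BM//|x Bx e1].
  by apply: nM; rewrite -e1; apply: BtM.
by move=> x Bx; rewrite sB //; apply: Bt.
Qed.

End Reduction.

(** * Subgroups normalized by the derived subgroup *)

Section Normalized.
Variables (R : realType) (d : nat).
Implicit Types (C : seq R) (x y o : point R d) (X W M E B : point R d -> Prop).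
Implicit Types (f g u v a b h : point R d -> point R d) (z : 'I_d -> nat).
Implicit Types (H : (point R d -> point R d) -> Prop).

Lemma two_free_slots (N a b : nat) : exists j1 j2,
  [/\ (j1 < 4)%N, (j2 < 4)%N, j1 <> j2,
     N + j1 <> a /\ N + j1 <> b & N + j2 <> a /\ N + j2 <> b]%N.
Proof.
pose free j := (N + j <> a /\ N + j <> b)%N.
have [h0|h0] := pselect (free 0%N); have [h1|h1] := pselect (free 1%N);
  have [h2|h2] := pselect (free 2%N); have [h3|h3] := pselect (free 3%N).
all: try by exists 0%N, 1%N.
all: try by exists 0%N, 2%N.
all: try by exists 0%N, 3%N.
all: try by exists 1%N, 2%N.
all: try by exists 1%N, 3%N.
all: try by exists 2%N, 3%N.
all: exfalso; move: h0 h1 h2 h3; rewrite /free; lia.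
Qed.

(* Two of the four diagonal cells of the block are neither [k] nor [l];
   flipping [E] and [u E] into them conjugates the exchange of [E] and [u E]
   to an involution of the block. *)
Lemma exchange_in_normalized o (e : R) (N : nat) M H u E k l :
  (0 < d)%N -> bounded M -> 0 < e -> (forall x, block o e N 4 x -> M x) ->
  is_subgroup H -> normalized_by H (derived (rec_on M)) ->
  (forall v, involution_on (block o e N 4) v -> H v) ->
  involution_on M u -> rset E ->
  (forall x, E x -> M x) -> (forall x, E x -> gcell o e k x) ->
  (forall x, E x -> gcell o e l (u x)) -> k <> l ->
  exists v, [/\ H v, forall x, E x -> v x = u x, forall x, E x -> v (u x) = x
    & forall x, ~ E x -> ~ E (u x) -> v x = x].
Proof.
move=> d0 bM e0 BM [Hid [Hc Hi]] Hn HB iu rE EM Ek El kl; have [ou uu pu] := iu.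
have cell_ne z z' x : z <> z' -> gcell o e z x -> ~ gcell o e z' x.
  by move=> zz h h'; apply: zz; rewrite -(gindex_gcell e0 h) (gindex_gcell e0 h').
pose i0 := Ordinal d0.
have [j1 [j2 [lt1 lt2 j12 [jk1 jl1] [jk2 jl2]]]] := two_free_slots N (k i0) (l i0).
pose m j : 'I_d -> nat := fun=> (N + j)%N.
have m_ne j z : (N + j)%N <> z i0 -> m j <> z by move=> h /(congr1 (@^~ i0)).
have mB j x : (j < 4)%N -> gcell o e (m j) x -> block o e N 4 x.
  move=> j4 h i; have [h1 h2] := h i; split.
    by apply: le_trans h1; rewrite lerD2l ler_pM2r // ler_nat leq_addr.
  apply: lt_le_trans h2 _; rewrite lerD2l ler_pM2r // ler_nat /m; lia.
pose t z j : point R d := fun i => ((m j i)%:R - (z i)%:R) * e.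
have tm z j x : gcell o e z x -> gcell o e (m j) (translate (t z j) x).
  move=> h i; have [h1 h2] := h i; rewrite /translate /t.
  by move: h1 h2; rewrite -!natr1; split; lra.
have tI z j x y : translate (t z j) x = translate (t z j) y -> x = y.
  by move=> e1; apply/funext => i; have := congr1 (@^~ i) e1; rewrite /translate => /addIr.
pose E' x := E (u x).
have rE' : rset E' by apply: rset_preim.
have E'l x : E' x -> gcell o e l x by move=> /El; rewrite uu.
have E'M x : E' x -> M x.
  by move=> /EM /(rec_on_maps (involution_on_rec iu)); rewrite uu.
have notE z x : gcell o e z x -> z <> k -> ~ E x by move=> h zk /Ek; apply: cell_ne h.
have notE' z x : gcell o e z x -> z <> l -> ~ E' x by move=> h zl /E'l; apply: cell_ne h.
have EE' x : E x -> ~ E' x by move=> Ex; apply: notE' (Ek _ Ex) kl.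
have m12 : m j1 <> m j2 by apply: m_ne => /addnI.
(* [v] agrees with [u] on E and u E and is the identity elsewhere. *)
have [||v [pv vv vE vo]] := flip_exists rE pu.
- by move=> x y _ _ /(congr1 u); rewrite !uu.
- exact: EE'.
have vE' x : E' x -> v x = u x.
  by move=> Ex; rewrite -{1}(uu x) -(vE (u x)) // vv.
have vo' x : ~ E x -> ~ E' x -> v x = x.
  by move=> nE nE'; apply: vo => // y Ey e1; apply: nE'; rewrite /E' -e1 uu.
(* Exchange a set lying in cell [z] with its translate in the diagonal cell [m j]. *)
have slot X z j : rset X -> (forall x, X x -> M x) -> (forall x, X x -> gcell o e z x) ->
    (j < 4)%N -> m j <> z ->
    exists w, [/\ involution_on M w, forall x, X x -> w x = translate (t z j) x
      & forall x, ~ X x -> ~ gcell o e (m j) x -> w x = x].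
  move=> rX XM Xz j4 mz.
  have [||w [pw ww wX wo]] := flip_exists rX (pwtrans_translate (t z j)).
  - by move=> x y _ _; apply: tI.
  - by move=> x Xx /Xz; apply: cell_ne mz _; apply/tm/Xz.
  exists w; split=> //.
    split=> // x nM; apply: wo => [/XM//|y Xy e1]; apply: nM; rewrite -e1.
    exact/BM/(mB j)/tm/Xz.
  by move=> x nX nm; apply: wo => // y Xy e1; apply: nm; rewrite -e1; apply/tm/Xz.
have [w1 [iw1 w1E w1o]] := slot E k j1 rE EM Ek lt1 (m_ne _ _ jk1).
have [w2 [iw2 w2E w2o]] := slot E' l j2 rE' E'M E'l lt2 (m_ne _ _ jl2).
have [_ w11 pw1] := iw1; have [_ w22 pw2] := iw2.
have conj w q : involution_on M w -> H q -> H (w \o q \o w).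
  move=> iw Hq; have [_ ww _] := iw; apply: Hn => //; try by apply/funext.
  by apply: invgen_derived => //; apply: invgen_involution.
pose v' := w2 \o w1 \o v \o w1 \o w2.
have iv' : involution_on (block o e N 4) v'.
  split; last by rewrite /v'; do 4![apply: pwtrans_comp => //].
    move=> x nB; have nm1 : ~ gcell o e (m j1) x by move=> /(mB _ _ lt1).
    have nm2 : ~ gcell o e (m j2) x by move=> /(mB _ _ lt2).
    rewrite /v' /=; have [Ex|nE] := pselect (E x).
      have g1 := tm _ j1 _ (Ek _ Ex); rewrite -w1E // in g1.
      rewrite (w2o x) //; last exact: EE'.
      rewrite (vo' (w1 x)) ?w11 ?w2o //; first exact: EE'.
        exact: notE g1 (m_ne _ _ jk1).
      exact: notE' g1 (m_ne _ _ jl1).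
    have [E'x|nE'] := pselect (E' x); last by rewrite (w2o x) // w1o // vo' // w1o // w2o.
    have g2 := tm _ j2 _ (E'l _ E'x); rewrite -w2E // in g2.
    have nE2 := notE _ _ g2 (m_ne _ _ jk2); have nE2' := notE' _ _ g2 (m_ne _ _ jl2).
    have nm12 : ~ gcell o e (m j1) (w2 x) by apply: cell_ne g2 => /esym.
    by rewrite (w1o (w2 x)) // vo' // w1o.
  by move=> x; rewrite /v' /= w22 w11 vv w11 w22.
exists v; split=> //.
  rewrite (_ : v = w1 \o (w2 \o v' \o w2) \o w1); first exact/conj/conj/HB.
  by apply/funext => x; rewrite /v' /= !w22 !w11.
by move=> x Ex; rewrite vE' /E' ?uu.
Qed.

(** The mesh is so fine that [u] sends every moved point to another cell. By induction over pairs of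
    cells, [u] is assembled from its exchanges between two cells. *)
Lemma involution_in_normalized M x0 (r : R) H u :
  (0 < d)%N -> bounded M -> rset M -> 0 < r ->
  (forall x, cube x0 r x -> M x) ->
  is_subgroup H -> subset_of H (rec_on M) -> normalized_by H (derived (rec_on M)) ->
  (forall v, involution_on (cube x0 r) v -> H v) ->
  involution_on M u -> H u.
Proof.
move=> d0 bM rM r0 QM sH Hrec Hn HQ iu; have [Hid [Hc Hi]] := sH; have [ou uu pu] := iu.
have [T hT] := pwtrans_disp pu.
(* With the opposites included, [tau] bounds the absolute value of every nonzero coordinate
   displacement from below. *)
have [tau tau0 tauP] := seq_lower_bound (T ++ [seq - p | p <- T]).
have [o [e [K [N [e0 et er bK [NK x0E]]]]]] := grid_exists x0 bM r0 tau0.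
have BQ y : block o e N 4 y -> cube x0 r y.
  move=> By i; have [] := By i; rewrite natrD mulrDl x0E => h1 h2.
  by apply/andP; split; lra.
have BM y (By : block o e N 4 y) := QM _ (BQ _ By).
have HB v : involution_on (block o e N 4) v -> H v.
  by move=> /(involution_on_sub BQ); apply: HQ.
pose cl (z : {ffun 'I_d -> 'I_K}) : 'I_d -> nat := fun i => z i.
have same z x : gcell o e z x -> gcell o e z (u x) -> u x = x.
  move=> h h'; apply/funext => i; apply/eqP; rewrite -subr_eq0; apply/negPn/negP => ne.
  have [a1 a2] := h i; have [b1 b2] := h' i; move: a2 b2; rewrite -!natr1 => a2 b2.
  have := hT x i; set p := u x i - x i in ne *.
  move: ne; rewrite neq_lt => /orP[p0|p0] pT.
    have := tauP (- p); rewrite mem_cat map_f ?orbT // oppr_gt0 => /(_ isT p0).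
    by rewrite /p; lra.
  by have := tauP p; rewrite mem_cat pT => /(_ isT p0); rewrite /p; lra.
pose I := ({ffun 'I_d -> 'I_K} * {ffun 'I_d -> 'I_K})%type.
pose Y (s : seq I) x := exists2 p, p \in s & [/\ M x, cl p.1 <> cl p.2
  & (gcell o e (cl p.1) x /\ gcell o e (cl p.2) (u x)) \/
    (gcell o e (cl p.2) x /\ gcell o e (cl p.1) (u x))].
have Mu x (Mx : M x) := rec_on_maps (involution_on_rec iu) Mx.
have Yu s x : Y s x -> Y s (u x).
  move=> [p ps [Mx ne c]]; exists p => //; split=> //; first exact: Mu.
  by rewrite uu; case: c => -[c1 c2]; [right|left].
suff [v Hv [vY vN]] : exists2 v, H v & (forall x, Y (enum {: I}) x -> v x = u x) /\
     forall x, ~ Y (enum {: I}) x -> v x = x.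
  rewrite (_ : u = v) //; apply/funext => x.
  have [Yx|nY] := pselect (Y (enum {: I}) x).
    by rewrite vY.
  rewrite vN //; have [Mx|] := pselect (M x); last exact: ou.
  have [z hz] := grid_cover e0 (bK _ Mx).
  have [z' hz'] := grid_cover e0 (bK _ (Mu _ Mx)).
  have [e1|ne] := pselect (cl z = cl z').
    by apply: same hz _; rewrite -[fun i => _]/(cl z) e1.
  case: nY; exists (z, z'); first by rewrite mem_enum.
  by split=> //; left.
elim: (enum _) => [|[k l] s [v Hv [vY vN]]].
  by exists id => //; split=> // x [].
have YS x : Y s x -> Y ((k, l) :: s) x.
  by move=> [p ps h]; exists p => //; rewrite inE ps orbT.
have [ekl|kl] := pselect (cl k = cl l).
  have YS' x : Y ((k, l) :: s) x -> Y s x.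
    by move=> [p]; rewrite inE => /orP[/eqP->|ps h]; [case|exists p].
  by exists v => //; split=> x; [move/YS'/vY|move=> nY; apply: vN => /YS].
have [_ _ pv] := Hrec _ Hv.
(* The condition [v x = x] excludes points already treated, for instance through the reversed
   pair. *)
pose E x := M x /\ (gcell o e (cl k) x /\ (gcell o e (cl l) (u x) /\ v x = x)).
have rE : rset E.
  apply: rsetI => //; apply: rsetI; first exact: rset_rect.
  by apply: rsetI; [apply: (rset_preim pu); apply: rset_rect|apply: rset_fixpoints].
have nYE x : Y s x -> ~ E x.
  move=> /vY vx [_ [g1 [g2 e1]]]; apply: kl.
  by rewrite -(gindex_gcell e0 g1) -(gindex_gcell e0 g2) -vx e1.
have [||||w [Hw wE wuE wo]] := @exchange_in_normalized o e N M H u E (cl k) (cl l)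
  d0 bM e0 BM sH Hn HB iu rE.
- by move=> x [].
- by move=> x [_ []].
- by move=> x [_ [_ []]].
- by [].
have EY x : E x -> Y ((k, l) :: s) x.
  by move=> [Mx [g1 [g2 _]]]; exists (k, l); [rewrite mem_head|split=> //; left].
exists (w \o v); first exact: Hc.
split=> x /=.
  have [Ysx _|nY [p]] := pselect (Y s x).
    rewrite vY // wo ?uu; [by []|exact/nYE/Yu|exact: nYE].
  rewrite vN // inE => /orP[/eqP->|ps h]; last by case: nY; exists p.
  case=> Mx _ /= [[g1 g2]|[g1 g2]].
    by apply: wE; split=> //; split=> //; split=> //; apply: vN.
  rewrite -{1}(uu x) wuE //; split; first exact: Mu.
  by split=> //; rewrite uu; split=> //; apply: vN => /Yu; rewrite uu.
move=> nY; rewrite vN => [|/YS//]; apply: wo => [/EY//|/EY/Yu]; rewrite uu.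
exact: nY.
Qed.

End Normalized.

(** * Minimality and simplicity of the derived subgroup *)

Lemma derived_sub_normalized (R : realType) (d : nat) (M : point R d -> Prop)
    (H : (point R d -> point R d) -> Prop) :
  (0 < d)%N -> rset M -> bounded M -> is_subgroup H -> subset_of H (rec_on M) ->
  nontrivial H -> normalized_by H (derived (rec_on M)) ->
  subset_of (derived (rec_on M)) H.
Proof.
move=> d0 rM bM sH Hrec [h [Hh h1]] Hn.
have [x0 [i hx]] : exists x0 i, h x0 i != x0 i.
  apply: contrapT => no; apply: h1; apply/funext => x; apply/funext => i.
  by apply/eqP/negPn/negP => ne; apply: no; exists x, i.
have [oh _ [Ch hC]] := Hrec _ Hh.
have Mx0 : M x0 by apply: contrapT => nM; move: hx; rewrite oh ?eqxx.
have [CM hM] := rM; have [r1 r10 r1P] := cube_same_cell (CM ++ Ch) x0.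
(* On the cube of side [r1], [h] is one translation; a side at most its displacement along [i] makes
   the cube disjoint from its image. *)
pose r := Num.min r1 `|h x0 i - x0 i|.
have r0 : 0 < r by rewrite lt_min r10 normr_gt0 subr_eq0.
have Qsc y : cube x0 r y -> same_cell CM x0 y /\ same_cell Ch x0 y.
  move=> Qy; apply/same_cell_cat/r1P => j; have /andP[-> /=] := Qy j.
  by move=> h2; apply: lt_le_trans h2 _; rewrite lerD2l ge_min lexx.
have QM y : cube x0 r y -> M y by move=> /Qsc[/hM q _]; apply: q.
have hQ y : cube x0 r y -> ~ cube x0 r (h y).
  move=> Qy /(_ i) /andP[a1 a2]; have /andP[b1 b2] := Qy i.
  have [_ /hC /(_ i) e] := Qsc _ Qy.
  have : r <= `|h x0 i - x0 i| by rewrite ge_min lexx orbT.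
  by rewrite e ler_normr => /orP[]; lra.
have HQ v : involution_on (cube x0 r) v -> H v.
  move=> iv; have [a [b [ia ib e]]] := involution_commutator d0 (bounded_sub QM bM) iv.
  exact: (@commutator_in_normalized _ _ M (cube x0 r) H h a b v).
move=> f /derived_invgen => /(_ d0 rM bM (ex_intro _ x0 Mx0)).
have [Hid [Hc _]] := sH; elim=> [|u {}f iu _ Hf] //; apply: Hc => //.
exact: (@involution_in_normalized _ _ M x0 r).
Qed.

(** The exchange of a small cube with a diagonal translate is a nontrivial involution, hence in the
    derived subgroup. *)
Lemma nontrivial_derived (R : realType) (d : nat) (M : point R d -> Prop) :
  (0 < d)%N -> rset M -> bounded M -> (exists x, M x) ->
  nontrivial (derived (rec_on M)).
Proof.
move=> d0 rM bM [x0 Mx0]; have [CM hM] := rM.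
have [r r0 rP] := cube_same_cell CM x0.
have QM y : cube x0 r y -> M y by move=> /rP h; apply: hM h Mx0.
pose t : point R d := fun=> r / 2.
have lt2 : r / 2 < r by lra.
have [||s [ps ss sX so]] := flip_exists (rset_rect x0 (translate t x0))
  (pwtrans_translate t).
- by move=> x y _ _ e; apply/funext => i; have := congr1 (@^~ i) e; rewrite /translate => /addIr.
- move=> x /(_ (Ordinal d0)) [a1 a2] /(_ (Ordinal d0)) [].
  by move: a2; rewrite /translate /t; lra.
have BM x : in_rect x0 (translate t x0) x -> M x /\ M (translate t x).
  move=> Bx; split; apply: QM => i; have [] := Bx i; rewrite /translate /t; lra.
have Bx0 : in_rect x0 (translate t x0) x0.
  by move=> i; rewrite /translate /t; lra.
exists s; split.
  apply: invgen_derived => //; apply: invgen_involution; split=> // y nM.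
  apply: so => [/BM[]//|x /BM[_ Mx] e]; apply: nM; by rewrite -e.
move=> s1; have := sX _ Bx0; rewrite s1 => /(congr1 (@^~ (Ordinal d0))).
by rewrite /translate /t /=; lra.
Qed.

Theorem mainTheorem3 (R : realType) (d : nat) (M : point R d -> Prop) :
  (1 <= d)%N -> multirectangle M -> (exists x, M x) ->
  (forall H, is_subgroup H -> subset_of H (in_Rec M) -> nontrivial H ->
     normalized_by H (derived (in_Rec M)) -> subset_of (derived (in_Rec M)) H) /\
  simple_group (derived (in_Rec M)) /\
  (forall N, normal_subgroup N (in_Rec M) -> nontrivial N ->
     subset_of (derived (in_Rec M)) N).
Proof.
move=> d0 mM M0; rewrite (in_RecE mM).
have rM := multirectangle_rset mM; have bM := multirectangle_bounded mM.
have key H := @derived_sub_normalized R d M H d0 rM bM.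
have D_rec := @derived_rec R d M.
split; first exact: key.
split; last first.
  move=> N [sN [NG nN]] N1; apply: key => // k k' h /D_rec; exact: nN.
split; first exact: nontrivial_derived.
move=> N [sN [ND nN]]; have [N1|N0] := pselect (nontrivial N).
  (* A normal subgroup of the derived subgroup is in particular normalized by it, so [key]
     applies. *)
  by right=> f; split; [apply: ND|apply: key => // g /ND /D_rec].
left=> f; split=> [Nf|->]; last by case: sN.
by apply: contrapT => f1; apply: N0; exists f.
Qed.
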